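(* Let $A$ be an associative conformal algebra. The graded associative algebra $\big(\bigoplus_{i\ge0}\mathrm{HH}^i(A),\sqcup\big)$, with the product induced by the cup product on Hochschild cochains, is graded commutative: for $f\in\mathrm{HH}^m(A)$ and $g\in\mathrm{HH}^n(A)$, $m,n\ge0$, one has $g\sqcup f=(-1)^{mn}f\sqcup g$.
   Context: Base field: $\mathbb C$ denotes a fixed algebraically closed field of characteristic zero; all vector spaces, linear maps and tensor products are over $\mathbb C$. For a vector space $V$, $V[\lambda_1,\dots,\lambda_k]$ is the space of polynomials in $\lambda_1,\dots,\lambda_k$ with coefficients in $V$. All operations are extended coefficientwise to polynomial-valued arguments. Associative conformal algebra: a $\mathbb C[\partial]$-module $A$ with a bilinear map $A\times A\to A[\lambda]$, $(a,b)\mapsto a_{(\lambda)}b$, such that for all $a,b,c\in A$: $(\partial a)_{(\lambda)}b=-\lambda\, a_{(\lambda)}b$, $a_{(\lambda)}(\partial b)=(\partial+\lambda)(a_{(\lambda)}b)$, $(a_{(\lambda)}b)_{(\lambda+\mu)}c=a_{(\lambda)}(b_{(\mu)}c)$. If $a_{(\lambda)}b=\sum_k\lambda^kc_k$, then $a_{(-\partial)}b:=\sum_k(-\partial)^kc_k$. Hochschild complex: $\mathcal C^0(A,A)=A/\partial A$, $\mathcal C^1(A,A)=\mathrm{Hom}_{\mathbb C[\partial]}(A,A)$, and for $n\ge2$, $\mathcal C^n(A,A)$ is the space of conformal sesquilinear maps, i.e. linear maps $\varphi:A^{\otimes n}\to A[\lambda_1,\dots,\lambda_{n-1}]$ with $\varphi_{\lambda_1,\dots,\lambda_{n-1}}(a_1,\dots,\partial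 a_i,\dots,a_n)=-\lambda_i\varphi_{\lambda_1,\dots,\lambda_{n-1}}(a_1,\dots,a_n)$ for $1\le i\le n-1$, and $\varphi_{\lambda_1,\dots,\lambda_{n-1}}(a_1,\dots,a_{n-1},\partial a_n)=(\partial+\lambda_1+\dots+\lambda_{n-1})\varphi_{\lambda_1,\dots,\lambda_{n-1}}(a_1,\dots,a_n)$. Differentials: $d_0(v+\partial A)(a)=a_{(-\partial)}v-v_{(0)}a$, and for $n\ge1$ $$d_n(\varphi)_{\lambda_1,\dots,\lambda_n}(a_1,\dots,a_{n+1})=a_1{}_{(\lambda_1)}\varphi_{\lambda_2,\dots,\lambda_n}(a_2,\dots,a_{n+1})+\sum_{i=1}^n(-1)^i\varphi_{\lambda_1,\dots,\lambda_{i-1},\lambda_i+\lambda_{i+1},\lambda_{i+2},\dots,\lambda_n}(a_1,\dots,a_{i-1},a_i{}_{(\lambda_i)}a_{i+1},a_{i+2},\dots,a_{n+1})+(-1)^{n+1}\varphi_{\lambda_1,\dots,\lambda_{n-1}}(a_1,\dots,a_n)_{(\lambda_1+\dots+\lambda_n)}a_{n+1}.$$ (In the term $i=n$, where the product is in the last argument, the subscript of $\varphi$ is $\lambda_1,\dots,\lambda_{n-1}$.) One has $d_{n+1}\circ d_n=0$; $\mathrm{HH}^n(A)=\ker d_n/\mathrm{im}\, d_{n-1}$ for $n\ge1$ and $\mathrm{HH}^0(A)=\ker d_0$. Cup product: for $f\in\mathcal C^m(A,A)$, $g\in\mathcal C^n(A,A)$, $m,n\ge1$, $$(f\sqcup g)_{\lambda_1,\dots,\lambda_{m+n-1}}(a_1,\dots,a_{m+n})=f_{\lambda_1,\dots,\lambda_{m-1}}(a_1,\dots,a_m)_{(\lambda_1+\dots+\lambda_m)}g_{\lambda_{m+1},\dots,\lambda_{m+n-1}}(a_{m+1},\dots,a_{m+n}).$$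 For $b\in\mathcal C^0(A,A)=A/\partial A$ (evaluated on any representative in $A$): $(b\sqcup g)_{\lambda_1,\dots,\lambda_{n-1}}(a_1,\dots,a_n)=b_{(0)}g_{\lambda_1,\dots,\lambda_{n-1}}(a_1,\dots,a_n)$ and $(f\sqcup b)_{\lambda_1,\dots,\lambda_{m-1}}(a_1,\dots,a_m)=f_{\lambda_1,\dots,\lambda_{m-1}}(a_1,\dots,a_m)_{(-\partial)}b$; for $b,b'\in A/\partial A$, $b\sqcup b'$ is the class of $b_{(0)}b'$ in $A/\partial A$. The product on cohomology is obtained by applying these formulas to representing cocycles. *)

(* Defs.v *)
From HB Require Import structures.
From mathcomp Require Import all_boot all_order all_algebra.
From mathcomp Require Import finmap.
From mathcomp.multinomials Require Import monalg.

Set Implicit Arguments.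
Unset Strict Implicit.
Unset Printing Implicit Defensive.

Import GRing.Theory.
Local Open Scope fset_scope.
Local Open Scope ring_scope.

Local Notation "1" := (@mone _) : monom_scope.
Local Notation "u * w" := (mmul u w) : monom_scope.

(* ------------------------------------------------------------------------ *)
(* [vpoly V k] is V[lambda_0, ..., lambda_(k-1)].  [{mpoly G[k]}] is the
   additive group of polynomials with coefficients in an abelian group G; for
   G = C it is the ring C[lambda_0, ..., lambda_(k-1)], over which [vpoly V k]
   is a module.  The alias keeps that module structure apart from the scaling
   that [monalg] puts on polynomials over a ring.
   [v%:MP] is the constant polynomial v, and [P@_u] the coefficient of P at
   the monomial u. *)

Definition vpoly (C : fieldType) (V : lmodType C) (k : nat) : Type :=
  {mpoly V[k]}.

HB.instance Definition _ (C : fieldType) (V : lmodType C) (k : nat) :=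
  GRing.Zmodule.on (vpoly V k).

Section PolynomialScaling.
Variables (C : fieldType) (V : lmodType C) (k : nat).
Implicit Types (q : {mpoly C[k]}) (P : vpoly V k).

Definition vscale q P : vpoly V k :=
  \sum_(u <- msupp q) \sum_(w <- msupp P) << q@_u *: P@_w *g (u * w)%M >>.

Lemma vscaleEw (d1 d2 : {fset 'X_{1..k}}) q P :
  msupp q `<=` d1 -> msupp P `<=` d2 ->
  vscale q P =
    \sum_(u <- d1) \sum_(w <- d2) << q@_u *: P@_w *g (u * w)%M >>.
Proof.
move=> le_d1 le_d2; rewrite /vscale (big_fset_incl _ le_d1) /=.
  apply/eq_bigr=> u _; apply/big_fset_incl => // w _ /mcoeff_outdom ->.
  by rewrite scaler0 monalgU0.
move=> u _ /mcoeff_outdom qu.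
by rewrite big1 => // w _; rewrite qu scale0r monalgU0.
Qed.

Lemma vscaleDr q : {morph vscale q : P Q / P + Q}.
Proof.
move=> P Q; have qq := fsubset_refl (msupp q).
rewrite (vscaleEw qq (msuppD_le P Q)).
rewrite (vscaleEw qq (fsubsetUl _ (msupp Q))).
rewrite (vscaleEw qq (fsubsetUr (msupp P) _)).
rewrite -big_split /=; apply/eq_bigr=> u _.
rewrite -big_split /=; apply/eq_bigr=> w _.
by rewrite mcoeffD scalerDr monalgUD.
Qed.

Lemma vscaleDl P : {morph vscale^~ P : p q / p + q}.
Proof.
move=> p q; have PP := fsubset_refl (msupp P).
rewrite (vscaleEw (msuppD_le p q) PP).
rewrite (vscaleEw (fsubsetUl _ (msupp q)) PP).
rewrite (vscaleEw (fsubsetUr (msupp p) _) PP).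
rewrite -big_split /=; apply/eq_bigr=> u _.
rewrite -big_split /=; apply/eq_bigr=> w _.
by rewrite mcoeffD scalerDl monalgUD.
Qed.

Lemma vscale0r P : vscale 0 P = 0.
Proof. by rewrite /vscale msupp0 big_seq_fset0. Qed.

Lemma vscaler0 q : vscale q 0 = 0.
Proof. by rewrite /vscale big1 // => u _; rewrite msupp0 big_seq_fset0. Qed.

Lemma vscaleUU (c : C) (v : V) (u w : 'X_{1..k}) :
  vscale << c *g u >> << v *g w >> = << c *: v *g (u * w)%M >>.
Proof. by rewrite (vscaleEw msuppU_le msuppU_le) !big_seq_fset1 !mcoeffUU. Qed.

Lemma vscale1r : left_id 1 vscale.
Proof.
move=> P; rewrite (vscaleEw msuppU_le (fsubset_refl _)) big_seq_fset1.
rewrite [RHS]monalgE; apply/eq_bigr=> u _.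
by rewrite mcoeffUU scale1r mul1m.
Qed.

Lemma vscaleA p q P : vscale p (vscale q P) = vscale (p * q) P.
Proof.
have suml r (I : Type) (s : seq I) (F : I -> vpoly V k) :
  vscale r (\sum_(i <- s) F i) = \sum_(i <- s) vscale r (F i).
  exact: (big_morph _ (vscaleDr r) (vscaler0 r)).
have sumr Q (I : Type) (s : seq I) (F : I -> {mpoly C[k]}) :
  vscale (\sum_(i <- s) F i) Q = \sum_(i <- s) vscale (F i) Q.
  exact: (big_morph (vscale^~ Q) (vscaleDl Q) (vscale0r Q)).
rewrite [p]monalgE [q]monalgE [P]monalgE mulr_suml !sumr.
apply/eq_bigr=> u _; rewrite mulr_sumr !sumr suml.
apply/eq_bigr=> w _; rewrite [X in vscale _ X = _]suml [LHS]suml [RHS]suml.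
apply/eq_bigr=> x _.
rewrite [X in vscale _ X = _]vscaleUU [LHS]vscaleUU.
rewrite [X in vscale X _](fgmulUU p@_u q@_w u w) [RHS]vscaleUU.
by rewrite scalerA mulmA.
Qed.

HB.instance Definition _ := GRing.Zmodule_isLmodule.Build {mpoly C[k]}
  (vpoly V k) vscaleA vscale1r vscaleDr (fun P p q => vscaleDl P p q).

End PolynomialScaling.

Definition lvar (C : fieldType) (k : nat) (i : 'I_k) : {mpoly C[k]} :=
  << ucm i >>.
Arguments lvar {C k} i.

Section PolynomialOperations.
Variables (C : fieldType) (V : lmodType C) (k r : nat).

(* P(s_0, ..., s_(k-1)) *)
Definition psubst (s : 'I_k -> {mpoly C[r]}) (P : vpoly V k) : vpoly V r :=
  \sum_(u <- msupp P) (\prod_(i < k) s i ^+ u i) *: ((P@_u)%:MP : vpoly V r).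

Definition map_vpoly (f : V -> V) (P : vpoly V k) : vpoly V k :=
  \sum_(u <- msupp P) << f P@_u *g u >>.

End PolynomialOperations.

(* Given a product [mu a b] in V[lambda], [lprod_of mu q P Q] is the product
   P_(q) Q in V[lambda_0, ..., lambda_(k-1)]: coefficientwise in P and Q, with
   the polynomial q substituted for lambda. *)
Definition lprod_of (C : fieldType) (V : lmodType C)
    (mu : V -> V -> vpoly V 1) (k : nat) (q : {mpoly C[k]})
    (P Q : vpoly V k) : vpoly V k :=
  \sum_(u <- msupp P) \sum_(w <- msupp Q)
    << (u * w)%M >> *: psubst (fun=> q) (mu P@_u Q@_w).

(* [del] is the action of the generator of C[del]; in [lmulA], lambda and mu
   are the variables 0 and 1. *)
Record assocConfAlg (C : fieldType) := AssocConfAlg {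
  carrier :> lmodType C;
  del : {linear carrier -> carrier};
  lmul : carrier -> carrier -> vpoly carrier 1;
  lmulPl : forall (c : C) (a a' b : carrier),
    lmul (c *: a + a') b = c%:MP *: lmul a b + lmul a' b;
  lmulPr : forall (c : C) (a b b' : carrier),
    lmul a (c *: b + b') = c%:MP *: lmul a b + lmul a b';
  lmul_dell : forall a b : carrier,
    lmul (del a) b = - lvar ord0 *: lmul a b;
  lmul_delr : forall a b : carrier,
    lmul a (del b) = map_vpoly del (lmul a b) + lvar ord0 *: lmul a b;
  lmulA : forall a b c : carrier,
    let la : {mpoly C[2]} := lvar ord0 in
    let mu : {mpoly C[2]} := lvar ord_max in
    lprod_of lmul (la + mu) (psubst (fun=> la) (lmul a b)) c%:MP =
    lprod_of lmul la a%:MP (psubst (fun=> mu) (lmul b c))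
}.
Arguments del {C _}.
Arguments lmul {C _}.

Section HochschildComplex.
Variables (C : fieldType) (A : assocConfAlg C).

Definition lprod (k : nat) := @lprod_of C A lmul k.

(* a_(-del) b *)
Definition mdel_prod (a b : A) : A :=
  \sum_(u <- msupp (lmul a b)) iter (u ord0) (fun x => - del x) (lmul a b)@_u.

(* a_(0) b *)
Definition zero_prod (a b : A) : A := (lmul a b)@_1%M.

(* The arguments of an n-cochain are indexed by 0, ..., n-1 and its variables
   by 0, ..., n-2, so a_i and lambda_i (counted from 1) are [a (i-1)] and [lvar (i-1)].
   A 0-cochain, i.e. an element of A / del A, is given by a representative in
   A; the quotient by del A is accounted for in [coboundary].  A 1-cochain
   takes its values in polynomials in no variables. *)
Definition cochain (n : nat) : Type :=
  if n is n'.+1 then {ffun 'I_n'.+1 -> A} -> vpoly A n' else A.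

Definition upd (n : nat) (a : {ffun 'I_n -> A}) (i : 'I_n) (x : A) :
  {ffun 'I_n -> A} := [ffun j => if j == i then x else a j].

Definition wid (n : nat) : 'I_n -> 'I_n.+1 := widen_ord (leqnSn n).

Record sesquilinear (n : nat) (phi : cochain n.+1) : Prop := Sesquilinear {
  sesq_linear : forall (a : {ffun 'I_n.+1 -> A}) (i : 'I_n.+1) (c : C) (x y : A),
    phi (upd a i (c *: x + y)) = c%:MP *: phi (upd a i x) + phi (upd a i y);
  sesq_del : forall (a : {ffun 'I_n.+1 -> A}) (i : 'I_n),
    phi (upd a (wid i) (del (a (wid i)))) = - lvar i *: phi a;
  sesq_del_last : forall a : {ffun 'I_n.+1 -> A},
    phi (upd a ord_max (del (a ord_max))) =
    map_vpoly del (phi a) + (\sum_(i < n) lvar i) *: phi a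
}.

(* [cochain n] is the type of all maps; this selects the space C^n(A, A). *)
Definition is_cochain (n : nat) : cochain n -> Prop :=
  if n is n'.+1 then @sesquilinear n' else fun=> True.

Definition diff0 (v : A) : cochain 1 :=
  fun a => (mdel_prod (a ord0) v - zero_prod v (a ord0))%:MP.

(* The variables to be substituted in the term of the differential that
   multiplies a_i and a_(i+1); if i = n this is lambda_0, ..., lambda_(n-1). *)
Definition merge_var (n : nat) (i : 'I_n.+1) (j : 'I_n) : {mpoly C[n.+1]} :=
  if (j < i)%N then lvar (wid j)
  else if j == i :> nat then lvar (wid j) + lvar (lift ord0 j)
  else lvar (lift ord0 j).

(* phi (a_0, ..., a_(i-1), a_i (lambda_i) a_(i+1), a_(i+2), ..., a_(n+1)),
   extended coefficientwise to its i-th argument; the index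
   [lift (lift ord0 i) j] is j if j <= i and j + 1 otherwise. *)
Definition merge_term (n : nat) (phi : cochain n.+1)
    (a : {ffun 'I_n.+2 -> A}) (i : 'I_n.+1) : vpoly A n.+1 :=
  let P := lmul (a (wid i)) (a (lift ord0 i)) in
  \sum_(u <- msupp P) lvar i ^+ u ord0 *:
    psubst (merge_var i)
      (phi [ffun j => if j == i then P@_u else a (lift (lift ord0 i) j)]).

Definition diffS (n : nat) (phi : cochain n.+1) : cochain n.+2 := fun a =>
  lprod (lvar ord0) (a ord0)%:MP
    (psubst (fun j => lvar (lift ord0 j)) (phi [ffun j => a (lift ord0 j)]))
  + \sum_(i < n.+1) (-1) ^+ i.+1 *: merge_term phi a i
  + (-1) ^+ n.+2 *:
    lprod (\sum_(i < n.+1) lvar i)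
      (psubst (fun j => lvar (wid j)) (phi [ffun j => a (wid j)]))
      (a ord_max)%:MP.

Definition diff (n : nat) : cochain n -> cochain n.+1 :=
  if n is n'.+1 then @diffS n' else diff0.

Definition cocycle (n : nat) (f : cochain n) : Prop :=
  is_cochain f /\ forall a, diff f a = 0.

(* f - g lies in im d_(n-1); for n = 0, f and g represent the same element of
   A / del A. *)
Definition coboundary (n : nat) : cochain n -> cochain n -> Prop :=
  if n is n'.+1 then fun f g =>
    exists2 h : cochain n', is_cochain h & forall a, f a - g a = diff h a
  else fun f g => exists h : A, f - g = del h.

(* f and g are cocycles that represent the same class in
   HH^n(A) = ker d_n / im d_(n-1). *)
Definition HH_eq (n : nat) (f g : cochain n) : Prop :=
  [/\ cocycle f, cocycle g & coboundary f g].

Definition cscale (n : nat) (c : C) : cochain n -> cochain n :=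
  if n is n'.+1 then fun f a => c%:MP *: f a else fun f => c *: f.

Definition ccast (m n : nat) (e : m = n) (f : cochain m) : cochain n :=
  ecast k (cochain k) e f.

Definition cup00 (b b' : A) : cochain 0 := zero_prod b b'.

Definition cup0S (n : nat) (b : A) (g : cochain n.+1) : cochain n.+1 :=
  fun a => map_vpoly (zero_prod b) (g a).

Definition cupS0 (m : nat) (f : cochain m.+1) (b : A) : cochain m.+1 :=
  fun a => map_vpoly (mdel_prod^~ b) (f a).

(* For degrees m + 1 and n + 1: f has the variables 0, ..., m-1 and g the
   variables m+1, ..., m+n. *)
Definition cupSS (m n : nat) (f : cochain m.+1) (g : cochain n.+1) :
    cochain (m.+1 + n.+1) :=
  fun a : {ffun 'I_(m.+1 + n.+1) -> A} =>
  lprod (\sum_(i < m + n.+1 | (i <= m)%N) lvar i)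
    (psubst (fun j => lvar (lshift n.+1 j)) (f [ffun j => a (lshift n.+1 j)]))
    (psubst (fun j => lvar (rshift m (lift ord0 j)))
       (g [ffun j => a (rshift m.+1 j)])).

Definition cup (m n : nat) : cochain m -> cochain n -> cochain (m + n) :=
  match m, n return cochain m -> cochain n -> cochain (m + n) with
  | 0, 0 => cup00
  | 0, n'.+1 => @cup0S n'
  | m'.+1, 0 => fun f b => ccast (esym (addn0 m'.+1)) (cupS0 f b)
  | m'.+1, n'.+1 => @cupSS m' n'
  end.

End HochschildComplex.

(* Main.v *)
(** Evaluate polynomials at points of the infinite field C.  A cochain of degree
    n >= 1 then becomes a function of n elements (t, a) of the algebra graded by
    the additive group of C whose product is (a e^s)(b e^t) = (a_(s) b) e^(s+t),
    and the conformal differential becomes the ordinary Hochschild differential.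
    For degrees m, n >= 1 Gerstenhaber's argument applies: with f o_i g the
    insertion of g in entry i of f, the coboundary of the sum of the
    (-1)^(i (n-1)) f o_i g is, up to sign, g cup f - (-1)^(mn) f cup g.
    If v is a 0-cocycle, then v_(0) is linear over del and satisfies
    v_(0) (a_(t) b) = (v_(0) a)_(t) b = a_(t) (v_(0) b), and f cup v = v cup f
    holds already for cochains. *)

From HB Require Import structures.
Require Import Defs.
From mathcomp Require Import all_boot all_order all_algebra.
From mathcomp Require Import finmap zify.
From mathcomp.multinomials Require Import monalg.

Set Implicit Arguments.
Unset Strict Implicit.
Unset Printing Implicit Defensive.

Import GRing.Theory.
Local Open Scope ring_scope.

(** * Evaluation of polynomials *)

(** A label on each element suffices because the conformal formulas combine variables only into
    sums: lambda_i + lambda_(i+1) and lambda_1 + ... + lambda_n are totals of labels, and products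
    add labels. Sesquilinearity then says that a cochain is compatible with the operator d + t on
    degree t, which annihilates as a left factor. An n-cochain has n - 1 variables, so it must not
    see the label of its last entry; this is what makes insertion into the last entry delicate.
    Streams are infinite so that faces, shifts and insertions of all arities act on one type,
    without casts between tuples. The way back has two costs. Identities return from values to
    polynomials only because characteristic zero provides enough points; and a coboundary must come
    from a polynomial cochain, so every insertion has to be realised by explicit polynomials. Degree
    0 stays apart, since a class modulo del A is no function of points. For two 0-cocycles the
    chosen representatives commute only modulo del A. *)

Section MalgSum.
Local Open Scope fset_scope.
Local Open Scope ring_scope.
Variables (K : choiceType) (G W : zmodType).

(** Additivity is a hypothesis, so that maps such as [fun p => pev l (p * q)] can be compared on
    monomials without declaring them as morphisms. *)
Lemma malg_eq (f g : {malg G[K]} -> W) :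
  {morph f : P Q / P + Q} -> {morph g : P Q / P + Q} ->
  (forall u v, f << v *g u >> = g << v *g u >>) -> f =1 g.
Proof.
move=> fD gD fg P; rewrite [P]monalgE.
have add0 (h : {malg G[K]} -> W) : {morph h : P Q / P + Q} -> h 0 = 0.
  by move=> hD; apply: (addrI (h 0)); rewrite -hD !addr0.
elim/big_rec: _ => [|u R _ IH]; first by rewrite !add0.
by rewrite fD gD fg IH.
Qed.

Variables (F : K -> G -> W) (FD : forall u, {morph F u : x y / x + y}).

Let F0 u : F u 0 = 0.
Proof. by apply: (addrI (F u 0)); rewrite -FD !addr0. Qed.

Lemma malg_sumU u v :
  \sum_(w <- msupp (<< v *g u >> : {malg G[K]})) F w (<< v *g u >>)@_w = F u v.
Proof.
rewrite (big_fset_incl _ msuppU_le) ?big_seq_fset1 ?mcoeffUU // => w _.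
by move=> /mcoeff_outdom ->.
Qed.

Lemma malg_sumD (P Q : {malg G[K]}) :
  \sum_(w <- msupp (P + Q)) F w (P + Q)@_w =
  \sum_(w <- msupp P) F w P@_w + \sum_(w <- msupp Q) F w Q@_w.
Proof.
have E (d : {fset K}) (R : {malg G[K]}) : msupp R `<=` d ->
    \sum_(w <- msupp R) F w R@_w = \sum_(w <- d) F w R@_w.
  by move=> le; apply: big_fset_incl => // w _ /mcoeff_outdom ->.
rewrite (E _ _ (msuppD_le P Q)) (E _ _ (fsubsetUl _ (msupp Q))).
rewrite (E _ _ (fsubsetUr (msupp P) _)) -big_split /=.
by apply: eq_bigr => w _; rewrite mcoeffD FD.
Qed.

End MalgSum.

Section Evaluation.
Variables (C : fieldType) (V : lmodType C) (k : nat).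
Implicit Types (l : 'I_k -> C) (P Q : vpoly V k) (q : {mpoly C[k]}).

Definition ev l P : V := \sum_(u <- msupp P) (\prod_(i < k) l i ^+ u i) *: P@_u.

Lemma eq_ev l l' P : l =1 l' -> ev l P = ev l' P.
Proof.
move=> e; apply: eq_bigr => u _; congr (_ *: _).
by apply: eq_bigr => i _; rewrite e.
Qed.

Lemma evD l : {morph ev l : P Q / P + Q}.
Proof.
move=> P Q.
apply: (@malg_sumD _ V V (fun (w : 'X_{1..k}) x => (\prod_(i < k) l i ^+ w i) *: x) ) => w x y.
exact: scalerDr.
Qed.

Lemma ev0 l : ev l 0 = 0.
Proof. by rewrite /ev msupp0 big_seq_fset0. Qed.

HB.instance Definition _ l :=
  GRing.isNmodMorphism.Build (vpoly V k) V (ev l) (conj (ev0 l) (evD l)).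

Lemma evU l (v : V) (u : 'X_{1..k}) :
  ev l << v *g u >> = (\prod_(i < k) l i ^+ u i) *: v.
Proof.
apply: (@malg_sumU _ V V (fun (w : 'X_{1..k}) x => (\prod_(i < k) l i ^+ w i) *: x)) => w x y.
exact: scalerDr.
Qed.

Lemma evC l (v : V) : ev l v%:MP = v.
Proof.
by rewrite evU big1 ?scale1r // => i _; rewrite cm1 expr0.
Qed.

End Evaluation.

(** Scalars are the regular module [C^o], so the results on [ev] apply; the separate name carries
    the ring morphism structure. *)
Definition pev (C : fieldType) k (l : 'I_k -> C) (q : {mpoly C[k]}) : C :=
  @ev C C^o k l q.

Section PolynomialEvaluation.
Variables (C : fieldType) (k : nat) (l : 'I_k -> C).
Implicit Types (p q : {mpoly C[k]}).

Lemma pevD : {morph pev l : p q / p + q}.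
Proof. exact: (@evD C C^o). Qed.

Lemma pev0 : pev l 0 = 0.
Proof. exact: (@ev0 C C^o). Qed.

Lemma pevU (c : C) (u : 'X_{1..k}) :
  pev l << c *g u >> = (\prod_(i < k) l i ^+ u i) * c.
Proof. exact: (@evU C C^o). Qed.

Lemma prod_expM (u w : 'X_{1..k}) :
  \prod_(i < k) l i ^+ (mmul u w) i =
  (\prod_(i < k) l i ^+ u i) * (\prod_(i < k) l i ^+ w i).
Proof. by rewrite -big_split; apply: eq_bigr => i _; rewrite cmM exprD. Qed.

Lemma pev_is_monoid : monoid_morphism (pev l).
Proof.
split=> [|p q].
  by rewrite -mpolyC1E pevU mulr1 big1 // => i _; rewrite cm1 expr0.
pose f p := pev l (p * q); pose g p := pev l p * pev l q.
apply: (malg_eq (f := f) (g := g)) => [x y|x y|u c].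
- by rewrite /f mulrDl; exact: pevD.
- by rewrite /g -mulrDl; congr (_ * _); exact: pevD.
pose f' q := pev l (<< c *g u >> * q); pose g' q := pev l << c *g u >> * pev l q.
apply: (malg_eq (f := f') (g := g')) => [x y|x y|w d].
- by rewrite /f' mulrDr; exact: pevD.
- by rewrite /g' -mulrDr; congr (_ * _); exact: pevD.
transitivity (pev l (@mkmalgU 'X_{1..k} C (mmul u w) (c * d))); first congr (pev l _).
  exact: fgmulUU.
apply: etrans (pevU _ _) _; rewrite (prod_expM u w) mulrACA.
by congr (_ * _); exact/esym/pevU.
Qed.

HB.instance Definition _ :=
  GRing.isNmodMorphism.Build {mpoly C[k]} C (pev l) (conj pev0 pevD).
HB.instance Definition _ :=
  GRing.isMonoidMorphism.Build {mpoly C[k]} C (pev l) pev_is_monoid.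

Lemma pevC (c : C) : pev l c%:MP = c.
Proof. exact: (@evC C C^o). Qed.

Lemma pev_lvar (i : 'I_k) : pev l (lvar i) = l i.
Proof.
rewrite pevU mulr1 (bigD1 i) //= cmUU expr1 big1 ?mulr1 // => j ji.
by rewrite cmU eq_sym (negPf ji).
Qed.

Variable V : lmodType C.

Lemma evZ (q : {mpoly C[k]}) (P : vpoly V k) : ev l (q *: P) = pev l q *: ev l P.
Proof.
pose f q := ev l (q *: P); pose g q := pev l q *: ev l P.
apply: (malg_eq (f := f) (g := g)) => [x y|x y|u c].
- by rewrite /f scalerDl; exact: evD.
- by rewrite /g -scalerDl; congr (_ *: _); exact: pevD.
pose f' (P : vpoly V k) := ev l (<< c *g u >> *: P).
pose g' (P : vpoly V k) := pev l << c *g u >> *: ev l P.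
apply: (malg_eq (f := f') (g := g')) => [x y|x y|w d].
- by rewrite /f' scalerDr; exact: evD.
- by rewrite /g' -scalerDr; congr (_ *: _); exact: evD.
transitivity (ev l (@mkmalgU 'X_{1..k} V (mmul u w) (c *: d))).
  by congr (ev l _); exact: vscaleUU.
apply: etrans (evU _ _ _) _; rewrite (prod_expM u w) scalerA mulrAC -scalerA.
by congr (_ *: _); [exact/esym/pevU | exact/esym/evU].
Qed.

End PolynomialEvaluation.

Section EvaluationOfOperations.
Variables (C : fieldType) (V : lmodType C) (k : nat) (l : 'I_k -> C).

Lemma ev_psubst r (s : 'I_r -> {mpoly C[k]}) (P : vpoly V r) :
  ev l (psubst s P) = ev (fun i => pev l (s i)) P.
Proof.
rewrite raddf_sum; apply: eq_bigr => u _ /=.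
by rewrite evZ evC rmorph_prod; congr (_ *: _); apply: eq_bigr => i _; rewrite rmorphXn.
Qed.

(* [L] is linear into a polynomial module, hence the scalars [c%:MP]. *)
Lemma ev_linear (W : lmodType C) r r' (s : 'I_r -> C) (t : 'I_r' -> C)
    (L : V -> vpoly W r') (P : vpoly V r) :
  (forall c x y, L (c *: x + y) = c%:MP *: L x + L y) ->
  \sum_(u <- msupp P) (\prod_(i < r) s i ^+ u i) *: ev t (L P@_u) =
  ev t (L (ev s P)).
Proof.
move=> Llin; have L0 : L 0 = 0.
  have := Llin 1 0 0; rewrite scaler0 addr0 mpolyC1E scale1r => e.
  by apply: (addrI (L 0)); rewrite addr0 -e.
have LZ c x : L (c *: x) = c%:MP *: L x by rewrite -[c *: x]addr0 Llin L0 addr0.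
have Lsum (I : Type) (e : seq I) (c : I -> C) (x : I -> V) :
    L (\sum_(i <- e) c i *: x i) = \sum_(i <- e) (c i)%:MP *: L (x i).
  by elim/big_rec2: _ => // i y1 y2 _ <-; rewrite Llin.
rewrite Lsum raddf_sum; apply: eq_bigr => u _ /=.
by rewrite evZ pevC.
Qed.

Lemma ev_map_vpoly (f : {linear V -> V}) (P : vpoly V k) :
  ev l (map_vpoly f P) = f (ev l P).
Proof.
rewrite !raddf_sum; apply: eq_bigr => u _ /=.
by rewrite evU linearZ.
Qed.

(** Two uses of [ev_linear], one per argument of [mu], collapse the double sum over coefficients. *)
Lemma ev_lprod_of (mu : V -> V -> vpoly V 1) (q : {mpoly C[k]}) (P Q : vpoly V k) :
  (forall b c x y, mu (c *: x + y) b = c%:MP *: mu x b + mu y b) ->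
  (forall b c x y, mu b (c *: x + y) = c%:MP *: mu b x + mu b y) ->
  ev l (lprod_of mu q P Q) = ev (fun=> pev l q) (mu (ev l P) (ev l Q)).
Proof.
move=> mul_l mul_r.
rewrite -(@ev_linear _ _ _ _ _ (mu^~ (ev l Q)) _ (mul_l (ev l Q))) raddf_sum /=.
apply: eq_bigr => u _.
rewrite -(@ev_linear _ _ _ _ _ (mu P@_u) _ (mul_r _)) raddf_sum scaler_sumr /=.
apply: eq_bigr => w _.
by rewrite evZ ev_psubst pevU mulr1 scalerA prod_expM.
Qed.

End EvaluationOfOperations.

(** * Polynomials are determined by their values in characteristic zero *)

Section Injectivity.
Variables (C : fieldType) (charC : [pchar C] =i pred0) (V : lmodType C).

(** Characteristic zero enters here: it supplies arbitrarily many distinct interpolation nodes. *)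
Let natrI : injective (fun n : nat => n%:R : C).
Proof.
have h := (pcharf0P C).1 charC.
have W m n : (m <= n)%N -> m%:R = n%:R :> C -> m = n.
  move=> le /eqP e; apply/eqP; rewrite eqn_leq le /= -subn_eq0.
  by rewrite -h natrB // subr_eq0 eq_sym.
by move=> m n; case: (leqP m n) => [/W//|/ltnW/W h' /esym/h'].
Qed.

(* The Vandermonde matrix at 0, ..., M - 1 is invertible. *)
Lemma vect_poly_eq0 M (v : 'I_M -> V) :
  (forall t : C, \sum_(e < M) t ^+ e *: v e = 0) -> forall e, v e = 0.
Proof.
move=> h e; pose W := Vandermonde M (\row_(j < M) (j%:R : C)).
have Wu : W \in unitmx.
  rewrite unitmxE det_Vandermonde unitfE; apply/prodf_neq0 => i _.
  apply/prodf_neq0 => j lt_ij; rewrite !mxE subr_eq0.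
  by apply: contraTneq lt_ij => /natrI /ord_inj ->; rewrite ltnn.
(* Weighting the values at the nodes by column e of the inverse matrix isolates [v e]. *)
have : \sum_j (invmx W) j e *: (\sum_(d < M) (j%:R : C) ^+ d *: v d) = 0.
  by rewrite big1 // => j _; rewrite h scaler0.
under eq_bigr do rewrite scaler_sumr; rewrite exchange_big /=.
rewrite (bigD1 e) //= [X in _ + X]big1 => [|d de].
  rewrite addr0; under eq_bigr do rewrite scalerA; rewrite -scaler_suml.
  have := mulmxV Wu => /matrixP/(_ e e); rewrite !mxE eqxx.
  under eq_bigr do rewrite !mxE mulrC.
  by move=> ->; rewrite scale1r.
under eq_bigr do rewrite scalerA; rewrite -scaler_suml.
have := mulmxV Wu => /matrixP/(_ d e); rewrite !mxE (negPf de) /=.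
under eq_bigr do rewrite !mxE mulrC.
by move=> ->; rewrite scale0r.
Qed.

(** Uniqueness of base N digits: the exponents of a monomial can be recovered from the single
    exponent left by Kronecker substitution. *)
Lemma digits_inj N k (u w : 'I_k -> nat) :
  (forall i, u i < N)%N -> (forall i, w i < N)%N ->
  (\sum_(i < k) u i * N ^ i = \sum_(i < k) w i * N ^ i)%N -> u =1 w.
Proof.
elim: k u w => [|k IHk] u w ltu ltw; first by move=> _ [].
have N0 : (0 < N)%N by apply: leq_ltn_trans (ltu ord0).
rewrite !big_ord_recl !muln1.
have E (x : 'I_k.+1 -> nat) : (\sum_(i < k) x (lift ord0 i) * N ^ lift ord0 i =
    (\sum_(i < k) x (lift ord0 i) * N ^ i) * N)%N.
  by rewrite big_distrl; apply: eq_bigr => i _; rewrite /bump /= expnSr mulnA.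
rewrite !E => e.
have e0 : u ord0 = w ord0.
  have := congr1 (modn^~ N) e.
  by rewrite !(addnC (_ ord0)) !modnMDl !modn_small.
move: e; rewrite e0 => /addnI /eqP; rewrite eqn_pmul2r // => /eqP /IHk H i.
case: (unliftP ord0 i) => [j ->|-> //]; apply: H => j'; [exact: ltu|exact: ltw].
Qed.

(* Kronecker substitution [l i = t ^+ (N ^ i)] separates the monomials of P. *)
Lemma ev_eq0 k (P : vpoly V k) : (forall l, ev l P = 0) -> P = 0.
Proof.
move=> h; pose N := (\max_(u <- msupp P) \max_(i < k) u i).+1.
have ltN u i : u \in msupp P -> (u i < N)%N.
  move=> uP; rewrite ltnS (leq_trans (leq_bigmax i)) //.
  exact: (@leq_bigmax_seq _ _ xpredT (fun u : 'X_{1..k} => \max_(i < k) u i)%N).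
pose code (u : 'X_{1..k}) := (\sum_(i < k) u i * N ^ i)%N.
pose M := (\max_(u <- msupp P) code u).+1.
have ltM u : u \in msupp P -> (code u < M)%N.
  by move=> uP; rewrite ltnS leq_bigmax_seq.
(* The coefficient of t ^ e after the substitution. Since N exceeds every exponent in P, at most one
   monomial contributes. *)
pose v (e : 'I_M) := \sum_(u <- msupp P | code u == e) P@_u.
have v0 : forall e, v e = 0.
  apply: vect_poly_eq0 => t; rewrite -[RHS](h (fun i => t ^+ (N ^ i)%N)).
  under eq_bigr do rewrite scaler_sumr.
  rewrite /ev (exchange_big_dep xpredT) //= big_seq [RHS]big_seq.
  apply: eq_bigr => u uP; rewrite (big_pred1 (Ordinal (ltM u uP))).
    rewrite /= /code expr_sum; congr (_ *: _).
    by apply: eq_bigr => i _; rewrite -exprM mulnC.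
  by move=> e; apply: eq_sym.
apply/malgP => u; rewrite mcoeff0; have [uP|] := boolP (u \in msupp P); last first.
  exact: mcoeff_outdom.
rewrite -[RHS](v0 (Ordinal (ltM u uP))) /v big_seq_cond (eq_bigl (pred1 u)).
  by rewrite -big_filter filter_pred1_uniq // ?big_seq1 // fset_uniq.
move=> w /=; apply/andP/eqP => [[wP /eqP cwu]|->]; last by rewrite eqxx.
by apply/eqP/cmP; apply: digits_inj cwu => i; apply: ltN.
Qed.

Lemma ev_inj k (P Q : vpoly V k) : (forall l, ev l P = ev l Q) -> P = Q.
Proof.
by move=> h; apply/subr0_eq/ev_eq0 => l; rewrite raddfB /= h subrr.
Qed.

End Injectivity.

(** * Cochains as functions on streams and Gerstenhaber's identity *)

(* Locked, since unification would otherwise compare polynomial expressions by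
   unfolding them. *)
Fact lprodv_key : unit. Proof. exact: tt. Qed.
Definition lprodv (C : fieldType) (A : assocConfAlg C) : C -> A -> A -> A :=
  locked_with lprodv_key (fun t a b => ev (fun=> t) (lmul a b)).

(** The sign (-1) ^ q squares to 1, so [L i] and [R i.+1] occur with the same sign and cancel. Only
    [R 0] and [L p] survive, and they are expressed by [U] and [W]. *)
Lemma signed_telescope (C : fieldType) (V : lmodType C) (p q : nat)
    (L R : nat -> V) (U W : V) :
  U + R 0%N = 0 -> (forall i, (i < p)%N -> L i + R i.+1 = 0) ->
  L p + (-1) ^+ p *: W = 0 ->
  \sum_(0 <= i < p.+1) (-1) ^+ (i * q) *: (L i + (-1) ^+ q *: R i) =
  - (-1) ^+ q *: U - (-1) ^+ (p * q + p) *: W.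
Proof.
move=> R0 LR Lp; set s : C := (-1) ^+ q.
have ss : s * s = 1 by rewrite -expr2 sqrr_sign.
have tel j : (j <= p)%N ->
    \sum_(0 <= i < j.+1) (-1) ^+ (i * q) *: (L i + s *: R i) =
    - s *: U + (-1) ^+ (j * q) *: L j.
  elim: j => [_|j IHj lt_jp].
    rewrite big_nat1 mul0n !scale1r addrC scaleNr; congr (_ + _).
    by apply/eqP; rewrite -addr_eq0 -scalerDr addrC R0 scaler0.
  rewrite big_nat_recr // (IHj (ltnW lt_jp)) -[LHS]addrA; congr (_ + _).
  have -> : (-1) ^+ (j * q) *: L j = - ((-1) ^+ (j.+1 * q) *: (s *: R j.+1)).
    rewrite scalerA mulSn exprD mulrAC ss mul1r -scalerN; congr (_ *: _).
    by apply/eqP; rewrite -addr_eq0 LR.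
  by rewrite scalerDr addrCA addNr addr0.
rewrite tel //; congr (_ + _); apply/eqP.
by rewrite exprD -scalerA -addr_eq0 -scalerDr Lp scaler0.
Qed.

Section Streams.
Variables (C : fieldType) (A : assocConfAlg C).

Lemma lprodvE t (a b : A) : lprodv t a b = ev (fun=> t) (lmul a b).
Proof. by rewrite /lprodv unlock. Qed.

Lemma lprodvDl t b c (x y : A) :
  lprodv t (c *: x + y) b = c *: lprodv t x b + lprodv t y b.
Proof. by rewrite !lprodvE lmulPl evD evZ pevC. Qed.

Lemma lprodvDr t b c (x y : A) :
  lprodv t b (c *: x + y) = c *: lprodv t b x + lprodv t b y.
Proof. by rewrite !lprodvE lmulPr evD evZ pevC. Qed.

HB.instance Definition _ t a :=
  GRing.isLinear.Build C A A *:%R (lprodv t a) (fun c x y => lprodvDr t a c x y).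

Lemma lprodvZl t b c (x : A) : lprodv t (c *: x) b = c *: lprodv t x b.
Proof.
have l0 : lprodv t 0 b = 0.
  by have := lprodvDl t b (-1) 0 0; rewrite scaler0 add0r scaleN1r addNr.
by rewrite -[c *: x]addr0 lprodvDl l0 addr0.
Qed.

Lemma lprodv_dell t (a b : A) : lprodv t (del a) b = - t *: lprodv t a b.
Proof. by rewrite !lprodvE lmul_dell evZ rmorphN /= pev_lvar. Qed.

Lemma lprodv_delr t (a b : A) :
  lprodv t a (del b) = del (lprodv t a b) + t *: lprodv t a b.
Proof. by rewrite !lprodvE lmul_delr evD ev_map_vpoly evZ pev_lvar. Qed.

Lemma lprodvA s t (a b c : A) :
  lprodv (s + t) (lprodv s a b) c = lprodv s a (lprodv t b c).
Proof.
pose l (i : 'I_2) := if i == ord0 then s else t.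
have E q (P Q : vpoly A 2) :
    ev l (lprod_of lmul q P Q) = lprodv (pev l q) (ev l P) (ev l Q).
  by rewrite !lprodvE; apply: ev_lprod_of => *; rewrite ?lmulPl ?lmulPr.
have := etrans (esym (E _ _ _)) (etrans (congr1 (ev l) (lmulA a b c)) (E _ _ _)).
have l0 : pev l (lvar ord0) = s by exact: pev_lvar.
have l1 : pev l (lvar ord_max) = t by exact: pev_lvar.
have subst v r (a' b' : A) :
    pev l v = r -> ev l (psubst (fun=> v) (lmul a' b')) = lprodv r a' b'.
  by move=> <-; rewrite lprodvE; apply: ev_psubst.
have cst v : ev l v%:MP = v by apply: evC.
have sum : pev l (lvar ord0 + lvar ord_max) = s + t.
  by apply: etrans (pevD _ _ _) _; congr (_ + _).
move=> H; apply: etrans (etrans H _).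
  by congr lprodv; apply: esym; [exact: sum | exact: subst | exact: cst].
by congr lprodv; [exact: l0 | exact: cst | exact: subst].
Qed.

(* [(t, a)] stands for a e^t in the algebra graded by the additive group of C
   in which (a e^s) (b e^t) = (a_(s) b) e^(s+t). *)
Local Notation point := (C * A)%type.
Implicit Types (x y : nat -> point) (F G : (nat -> point) -> A).

Definition act (p : point) (a : A) : A := lprodv p.1 p.2 a.

HB.instance Definition _ p :=
  GRing.isLinear.Build C A A *:%R (act p) (fun c a b => lprodvDr p.1 p.2 c a b).

Definition pmul (p q : point) : point := (p.1 + q.1, act p q.2).

(* The operator d + t on the component of degree t. *)
Definition pdel (p : point) : point := (p.1, del p.2 + p.1 *: p.2).

Lemma actA p q a : act (pmul p q) a = act p (act q a).
Proof. exact: lprodvA. Qed.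

(** In a left factor of degree t, [del] acts as -t. *)
Lemma act_pdel p a : act (pdel p) a = 0.
Proof.
rewrite /act /pdel /= -[del p.2]scale1r lprodvDl lprodvZl lprodv_dell scale1r scaleNr.
exact: addNr.
Qed.

Lemma act_pdelr p q : act p (pdel q).2 = del (act p q.2) + (p.1 + q.1) *: act p q.2.
Proof.
by rewrite /act linearD linearZ /= lprodv_delr -addrA -scalerDl.
Qed.

(* A cochain of degree n is a function of the entries 0, ..., n - 1 of a
   stream; it does not depend on the first component of entry n - 1. *)
Definition label x n : C := \sum_(0 <= i < n) (x i).1.
Definition hat n F x : point := (label x n, F x).
Definition shift i x j : point := x (i + j)%N.
Definition face k x j : point :=
  if (j < k)%N then x j else if j == k then pmul (x k) (x k.+1) else x j.+1.
Definition put i v x j : point := if j == i then v else x j.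
(* Replaces the entries i, ..., i + n by v. *)
Definition ins i n v x j : point :=
  if (j < i)%N then x j else if j == i then v else x (j + n)%N.

Definition dstream n F x : A :=
  act (x 0%N) (F (shift 1 x))
  + \sum_(0 <= k < n) (-1) ^+ k.+1 *: F (face k x)
  + (-1) ^+ n.+1 *: act (hat n F x) (x n).2.

(** Here n is the number of variables, so F has n + 1 entries. The rule for an inner entry becomes
    vanishing on the image of d + t. In the last entry d + t passes to the value, whose degree is
    the total of all n + 1 labels; the last label is added on both sides. *)
Record sesq n F : Prop := Sesq {
  sesq_loc : forall x y, (forall j, (j < n)%N -> x j = y j) ->
    (x n).2 = (y n).2 -> F x = F y;
  sesq_lin : forall x j t c a b, (j <= n)%N ->
    F (put j (t, c *: a + b) x) = c *: F (put j (t, a) x) + F (put j (t, b) x);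
  sesq_kill : forall x j, (j < n)%N -> F (put j (pdel (x j)) x) = 0;
  sesq_last : forall x,
    F (put n (pdel (x n)) x) = del (F x) + label x n.+1 *: F x
}.

Definition scup p F G x : A := act (hat p.+1 F x) (G (shift p.+1 x)).
Definition scomp i F q G x : A := F (ins i q (hat q.+1 G (shift i x)) x).

Lemma eq_label x y n : (forall j, (j < n)%N -> x j = y j) -> label x n = label y n.
Proof. by move=> e; apply: eq_big_nat => i; move=> /andP[_ /e ->]. Qed.

Lemma labelS x n : label x n.+1 = label x n + (x n).1.
Proof. exact: big_nat_recr. Qed.

Lemma label_add x m n : label x (m + n) = label x m + label (shift m x) n.
Proof.
elim: n => [|n IHn]; first by rewrite /label [X in _ + X]big_geq // addn0 addr0.
by rewrite addnS !labelS IHn addrA.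
Qed.

Lemma label_ins i q v x n : (i <= n)%N -> v.1 = label (shift i x) q.+1 ->
  label (ins i q v x) n.+1 = label x (n + q).+1.
Proof.
move=> /subnKC <- ev; elim: (n - i)%N => [|m IHm].
  rewrite addn0 labelS -addnS label_add -ev; congr (_ + _).
    by apply: eq_label => j lt_ji; rewrite /ins lt_ji.
  by rewrite /ins ltnn eqxx.
rewrite addnS labelS IHm addSn [RHS]labelS; congr (_ + _).
by rewrite /ins; do ?case: ifP => // ?; try lia; congr (fst (x _)); lia.
Qed.

Lemma label_face k x n : (k < n)%N -> label (face k x) n = label x n.+1.
Proof.
move=> /subnKC <-; elim: (n - k.+1)%N => [|m IHm].
  rewrite addn0 !labelS /face ltnn eqxx /= addrA; congr (_ + _ + _).
  by apply: eq_label => j ->.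
rewrite addnS labelS IHm [RHS]labelS; congr (_ + _).
by rewrite /face; do ?case: ifP => // ?; try lia.
Qed.

Lemma label_shift1 x n : label x n.+1 = (x 0%N).1 + label (shift 1 x) n.
Proof. by rewrite -add1n label_add /label big_nat1. Qed.

Lemma sesq_ext n F : sesq n F -> forall x y, x =1 y -> F x = F y.
Proof. by move=> sF x y e; apply: (sesq_loc sF) => [j _|]; rewrite e. Qed.

Lemma ins_linear p i n F x a b t c : sesq p F -> (i <= p)%N ->
  F (ins i n (t, c *: a + b) x) = c *: F (ins i n (t, a) x) + F (ins i n (t, b) x).
Proof.
move=> sF le_ip.
have E d : F (ins i n (t, d) x) = F (put i (t, d) (ins i n (t, a) x)).
  apply: (sesq_ext sF) => j; rewrite /put /ins.
  by do ?case: ifP => // ?; try lia.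
by rewrite !E (sesq_lin sF).
Qed.

(** * The coboundary of a single insertion *)

Section Composition.
Variables (p q i : nat) (F G : (nat -> point) -> A) (x : nat -> point).
Hypotheses (sF : sesq p F) (sG : sesq q G).
Let m := (p + q).+1.

(** The terms of the coboundary of f o_i g to the left of g. The last summand is not one of its
    faces: it comes from the cocycle equation of G and completes this half to a half of a coboundary
    of F. *)
Definition left_part : A :=
  act (x 0%N) (scomp i F q G (shift 1 x))
  + \sum_(0 <= k < i) (-1) ^+ k.+1 *: scomp i F q G (face k x)
  + (-1) ^+ i.+1 *: F (ins i q.+1 (pmul (x i) (hat q.+1 G (shift i.+1 x))) x).

(** The mirror image of [left_part]. Faces are numbered as if G filled one entry; renumbering by q
    produces the factor (-1) ^ q in [dstream_comp]. *)
Definition right_part : A :=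
  (-1) ^+ i.+1 *: F (ins i q.+1 (pmul (hat q.+1 G (shift i x)) (x (i + q.+1)%N)) x)
  + \sum_(i.+1 <= k < p.+1) (-1) ^+ k.+1 *: scomp i F q G (face (k + q)%N x)
  + (-1) ^+ p *: act (hat m (scomp i F q G) x) (x m).2.

(** The faces i, ..., i + q multiply two inputs of G. Applying F, linear in entry i, to the cocycle
    equation of G trades them for the two products of the value of G with its neighbours. *)
Lemma dstream_comp : (i <= p)%N -> dstream q.+1 G (shift i x) = 0 ->
  dstream m (scomp i F q G) x = left_part + (-1) ^+ q *: right_part.
Proof.
move=> le_ip dG.
(* All terms of the equation for G have the same total label t; with t fixed, entry i of F is a
   linear function of the vector alone. *)
pose t := label (shift i x) q.+2; pose L a := F (ins i q.+1 (t, a) x).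
pose Llin := GRing.isLinear.Build C A A *:%R L
  (fun c a b => ins_linear q.+1 x a b t c sF le_ip).
pose LL : {linear A -> A} := HB.pack L Llin.
have LE a : LL a = F (ins i q.+1 (t, a) x) by [].
have faceE k : (k < q.+1)%N ->
    LL (G (face k (shift i x))) = scomp i F q G (face (k + i)%N x).
  move=> lt_kq; rewrite LE; apply: (sesq_ext sF) => j; rewrite /ins.
  have E : shift i (face (k + i)%N x) =1 face k (shift i x).
    move=> j'; rewrite /shift /face.
    by do ?case: ifP => // ?; try lia; rewrite ?addnS //; congr (pmul (x _) (x _)); lia.
  case: ifP => ?; first by rewrite /face; case: ifP => //; lia.
  case: ifP => ?.
    rewrite /hat (sesq_ext sG E) (eq_label (y := face k (shift i x))) //.
    by rewrite label_face.
  by rewrite /face; do ?case: ifP => // ?; try lia; congr (x _); lia.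
have := congr1 LL dG.
rewrite (linear0 LL) /dstream !(linearD LL) (linear_sum LL) (linearZ_LR LL).
have SE : \sum_(0 <= k < q.+1) LL ((-1) ^+ k.+1 *: G (face k (shift i x))) =
    \sum_(0 <= k < q.+1) (-1) ^+ k.+1 *: scomp i F q G (face (k + i)%N x).
  by apply: eq_big_nat => k /andP[_ lt_kq]; rewrite (linearZ_LR LL) faceE.
rewrite SE => dGL.
rewrite /left_part /right_part /dstream.
rewrite (@big_cat_nat _ _ _ i) //=; last by rewrite /m; lia.
rewrite (@big_cat_nat _ _ _ (i + q.+1)%N i) //=; try by rewrite /m; lia.
have -> : \sum_(i + q.+1 <= k < m) (-1) ^+ k.+1 *: scomp i F q G (face k x) =
   (-1) ^+ q *: \sum_(i.+1 <= k < p.+1) (-1) ^+ k.+1 *: scomp i F q G (face (k + q)%N x).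
  rewrite scaler_sumr -addSnnS big_addn.
  rewrite (_ : (m - q = p.+1)%N); last by rewrite /m; lia.
  by apply: eq_bigr => k _; rewrite scalerA -exprD; congr (_ ^+ _ *: _); lia.
have -> : \sum_(i <= k < i + q.+1) (-1) ^+ k.+1 *: scomp i F q G (face k x) =
   (-1) ^+ i *: \sum_(0 <= k < q.+1) (-1) ^+ k.+1 *: scomp i F q G (face (k + i)%N x).
  rewrite scaler_sumr -{1}[i]add0n big_addn addKn.
  by apply: eq_bigr => k _; rewrite scalerA -exprD; congr (_ ^+ _ *: _); lia.
have -> : F (ins i q.+1 (pmul (x i) (hat q.+1 G (shift i.+1 x))) x) =
    LL (act (shift i x 0) (G (shift 1 (shift i x)))).
  have E : shift 1 (shift i x) =1 shift i.+1 x.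
    by move=> j; rewrite /shift; congr (x _); lia.
  rewrite LE /t label_shift1 (sesq_ext sG E) /shift /pmul /= addn0.
  congr (F (ins _ _ (_ + _, _) _)).
  by apply: eq_label => j _; congr (x _); lia.
have -> : F (ins i q.+1 (pmul (hat q.+1 G (shift i x)) (x (i + q.+1)%N)) x) =
    LL (act (hat q.+1 G (shift i x)) (shift i x q.+1).2).
  by rewrite LE /t labelS.
move: dGL; set P := act (x 0%N) _; set Q := act _ (x m).2.
set B := LL _; set M := \sum_(0 <= k < q.+1) _; set R := LL _ => dGL.
have sgn2 n : (-1) ^+ n.+2 = (-1) ^+ n :> C by rewrite !exprS !mulN1r opprK.
have -> : M = - B - (-1) ^+ q *: R.
  by rewrite -[RHS]addr0 -dGL sgn2 addrACA addNr addr0 addrA addNr add0r.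
rewrite /m sgn2 !scalerDr !scalerN !scalerA -!exprD -!addrA; do 2 congr (_ + _).
rewrite -scaleNr -mulN1r -exprS; congr (_ + _).
rewrite -scaleNr -mulN1r -exprS.
by congr (_ ^+ _ *: _ + (_ + _ ^+ _ *: _)); lia.
Qed.

(** The stream at which the cocycle equation of F is used, with the value of G as one of its p + 2
    relevant entries. *)
Definition spliced : nat -> point := ins i q (hat q.+1 G (shift i x)) x.

(** The coboundary of F at a spliced stream is cut just before the face that multiplies the value of
    G by its right neighbour. *)
Lemma spliced_back : (i <= p)%N ->
  \sum_(i <= k < p.+1) (-1) ^+ k.+1 *: F (face k spliced)
  + (-1) ^+ p.+2 *: act (hat p.+1 F spliced) (spliced p.+1).2 = right_part.
Proof.
move=> le_ip; rewrite big_ltn //; congr (_ *: _ + _ + _).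
- apply: (sesq_ext sF) => j; rewrite /face /spliced /ins.
  do ?case: ifP => // ?; try lia; try by congr (x _); lia.
  by congr (pmul _ (x _)); lia.
- apply: eq_big_nat => k /andP[lt_ik lt_kp]; congr (_ *: _).
  have E j : (j <= q)%N -> shift i (face (k + q) x) j = shift i x j.
    by move=> le_jq; rewrite /shift /face; case: ifP => //; lia.
  have EG : hat q.+1 G (shift i (face (k + q) x)) = hat q.+1 G (shift i x).
    congr pair; first by apply: eq_label => j lt_jq; apply: E.
    by apply: (sesq_loc sG) => [j lt_jq|]; rewrite E // ltnW.
  rewrite /scomp EG; apply: (sesq_ext sF) => j; rewrite /face /spliced /ins.
  do ?case: ifP => // ?; try lia; try by congr (x _); lia.
- rewrite !exprS !mulN1r opprK; congr (_ *: act (_, _) _).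
    by apply: label_ins.
  by rewrite /spliced /ins; do ?case: ifP => // ?; try lia; congr (x _).2; lia.
Qed.

End Composition.

(** * Cancellation between neighbouring insertions *)

Section Gerstenhaber.
Variables (p q : nat) (F G : (nat -> point) -> A) (x : nat -> point).
Hypotheses (sF : sesq p F) (sG : sesq q G).

Lemma spliced_front i : (i <= p)%N ->
  act (spliced q i.+1 G x 0%N) (F (shift 1 (spliced q i.+1 G x)))
  + \sum_(0 <= k < i.+1) (-1) ^+ k.+1 *: F (face k (spliced q i.+1 G x))
  = left_part q i F G x.
Proof.
move=> le_ip; rewrite big_nat_recr //= addrA; congr (act _ _ + _ + _ *: _).
- apply: eq_big_nat => k /andP[_ lt_ki]; rewrite /scomp; congr (_ *: _).
  have E : shift i.+1 x =1 shift i (face k x).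
    by move=> j; rewrite /shift /face; do ?case: ifP => // ?; try lia; congr (x _); lia.
  apply: (sesq_ext sF) => j; rewrite /face /spliced /ins.
  do ?case: ifP => // ?; try lia; try by congr (x _); lia.
  congr pair; first by apply: eq_label => j' _; apply: E.
  exact: (sesq_ext sG).
- apply: (sesq_ext sF) => j; rewrite /face /spliced /ins.
  do ?case: ifP => // ?; try lia; try by congr (x _); lia.
Qed.

(** G can be spliced into p + 2 places of the coboundary of F. Each inner place i + 1 gives
    [L i + R i.+1 = 0]. At place 0 the first term of the coboundary is the product of G and F, and
    at place p + 1 its last term is the product of F and G; these are the two ends of the
    telescope. *)
Lemma gerstenhaber :
  (forall y, dstream p.+1 F y = 0) -> (forall y, dstream q.+1 G y = 0) ->
  \sum_(0 <= i < p.+1) (-1) ^+ (i * q) *: dstream (p + q).+1 (scomp i F q G) x =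
  - (-1) ^+ q *: scup q G F x - (-1) ^+ (p * q + p) *: scup p F G x.
Proof.
move=> dF dG; pose s : C := (-1) ^+ q.
pose L i := left_part q i F G x; pose R i := right_part p q i F G x.
have dE i : (i <= p)%N -> dstream (p + q).+1 (scomp i F q G) x = L i + s *: R i.
  by move=> le_ip; apply: dstream_comp.
have R0 : scup q G F x + R 0%N = 0.
  rewrite /R -(spliced_back x sF sG) //.
  rewrite -[RHS](dF (spliced q 0 G x)) /dstream -addrA; congr (act _ _ + _).
  by apply: (sesq_ext sF) => j; rewrite /shift /spliced /ins /=; congr (x _); lia.
have LR i : (i < p)%N -> L i + R i.+1 = 0.
  move=> lt_ip; rewrite /R -(spliced_back x sF sG) // /L -spliced_front ?(ltnW lt_ip) //.
  rewrite -[RHS](dF (spliced q i.+1 G x)) /dstream (@big_cat_nat _ _ _ i.+1 0 p.+1) //=.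
    by rewrite !addrA.
  by rewrite ltnW.
have Lp : L p + (-1) ^+ p *: scup p F G x = 0.
  rewrite /L -spliced_front // -[RHS](dF (spliced q p.+1 G x)) /dstream; congr (_ + _).
  rewrite !exprS !mulN1r opprK /spliced; congr (_ *: act _ _).
    congr pair; first by apply: eq_label => j lt_jp; rewrite /ins lt_jp.
    by apply: (sesq_loc sF) => [j lt_jp|]; rewrite /ins ?ltnSn // ltnS ltnW.
  by rewrite /ins ltnn eqxx.
have -> : \sum_(0 <= i < p.+1) (-1) ^+ (i * q) *: dstream (p + q).+1 (scomp i F q G) x =
    \sum_(0 <= i < p.+1) (-1) ^+ (i * q) *: (L i + s *: R i).
  by apply: eq_big_nat => i /andP[_ le_ip]; rewrite dE.
exact: signed_telescope.
Qed.

End Gerstenhaber.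
End Streams.

(** * Cup products and compositions on streams *)

Section StreamCochains.
Variables (C : fieldType) (A : assocConfAlg C).
Local Notation point := (C * A)%type.
Implicit Types (x y : nat -> point) (F G : (nat -> point) -> A).

Lemma lprodv0l t b : lprodv t (0 : A) b = 0.
Proof. by have := lprodvZl t b 0 0; rewrite !scale0r. Qed.

Lemma label_put n j t (a b : A) x : label (put j (t, a) x) n = label (put j (t, b) x) n.
Proof.
by apply: eq_big_nat => k _; rewrite /put; case: ifP.
Qed.

(** This is [sesq_last] for homogeneous elements. When the value of F is an inner entry or a left
    factor, [sesq_kill] or [act_pdel] then applies. *)
Lemma hat_put_pdel n F x : sesq n F ->
  hat n.+1 F (put n (pdel (x n)) x) = pdel (hat n.+1 F x).
Proof.
move=> sF; rewrite /hat /pdel /= (sesq_last sF); congr (_, _).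
by apply: eq_big_nat => k _; rewrite /put; case: eqP => // ->.
Qed.

Lemma eq_dstream n F G x : F =1 G -> dstream n F x = dstream n G x.
Proof.
move=> e; rewrite /dstream /hat !e; congr (_ + _ + _).
by apply: eq_bigr => k _; rewrite e.
Qed.

Lemma eq_sesq n F G : F =1 G -> sesq n F -> sesq n G.
Proof.
move=> e sF; split=> *; rewrite -!e; [exact: (sesq_loc sF)|exact: (sesq_lin sF)| |].
  exact: (sesq_kill sF).
exact: (sesq_last sF).
Qed.

Lemma sesq_lincomb n c F G : sesq n F -> sesq n G ->
  sesq n (fun x => c *: F x + G x).
Proof.
move=> sF sG; split.
- by move=> x y e e'; rewrite (sesq_loc sF e e') (sesq_loc sG e e').
- move=> x j t d a b le_jn; rewrite (sesq_lin sF) // (sesq_lin sG) //.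
  by rewrite !scalerDr !scalerA [c * d]mulrC addrACA.
- by move=> x j lt_jn; rewrite (sesq_kill sF) // (sesq_kill sG) // scaler0 addr0.
- move=> x; rewrite (sesq_last sF) (sesq_last sG) linearP !scalerDr !scalerA.
  by rewrite [c * _]mulrC addrACA.
Qed.

Lemma sesq0 n : sesq n (fun=> 0 : A).
Proof. by split=> *; rewrite ?scaler0 ?linear0 ?addr0. Qed.

Lemma sesq_sum n m (c : nat -> C) (F : nat -> (nat -> point) -> A) :
  (forall i, (i < m)%N -> sesq n (F i)) ->
  sesq n (fun x => \sum_(0 <= i < m) c i *: F i x).
Proof.
elim: m => [|m IHm] sF.
  by apply: eq_sesq (sesq0 n) => x; rewrite big_geq.
have IH := sesq_lincomb (c m) (sF m (ltnSn m)) (IHm (fun i lt_im => sF i (ltnW lt_im))).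
have E x : \sum_(0 <= i < m.+1) c i *: F i x =
    c m *: F m x + \sum_(0 <= i < m) c i *: F i x by rewrite big_nat_recr //= addrC.
by apply: eq_sesq IH => x; rewrite E.
Qed.

Lemma dstream_lincomb n c F G x :
  dstream n (fun x => c *: F x + G x) x = c *: dstream n F x + dstream n G x.
Proof.
rewrite /dstream linearP /= /act lprodvDl !scalerDr scaler_sumr.
have -> : \sum_(0 <= k < n) (-1) ^+ k.+1 *: (c *: F (face k x) + G (face k x)) =
  \sum_(0 <= k < n) c *: ((-1) ^+ k.+1 *: F (face k x))
  + \sum_(0 <= k < n) (-1) ^+ k.+1 *: G (face k x).
  by rewrite -big_split; apply: eq_bigr => k _; rewrite scalerDr !scalerA [_ * c]mulrC.
rewrite !scalerA [_ * c]mulrC.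
by rewrite (addrACA (c *: lprodv _ _ _) (lprodv _ _ _)) (addrACA (_ + _)).
Qed.

Lemma dstream_sum n m (c : nat -> C) (F : nat -> (nat -> point) -> A) x :
  dstream n (fun x => \sum_(0 <= i < m) c i *: F i x) x =
  \sum_(0 <= i < m) c i *: dstream n (F i) x.
Proof.
have ext F' G' : F' =1 G' -> dstream n F' x = dstream n G' x := fun e => eq_dstream n x e.
elim: m => [|m IHm].
  rewrite big_geq // (ext _ (fun=> 0)) => [|y]; last by rewrite big_geq.
  rewrite /dstream linear0 big1 => [|k _]; last exact: scaler0.
  by rewrite /act lprodv0l scaler0 !addr0.
rewrite big_nat_recr //= -IHm addrC -dstream_lincomb; apply: ext => y.
by rewrite big_nat_recr //= addrC.
Qed.

(** * Sesquilinearity and cocycles under products and insertions *)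

Section Closure.
Variables (p q : nat) (F G : (nat -> point) -> A).
Hypotheses (sF : sesq p F) (sG : sesq q G).

Lemma scup_putl j v x : (j <= p)%N ->
  scup p F G (put j v x) = act (hat p.+1 F (put j v x)) (G (shift p.+1 x)).
Proof.
move=> le_jp; congr act; apply: (sesq_ext sG) => k.
by rewrite /shift /put; case: eqP => //; lia.
Qed.

Lemma scup_putr j v x :
  scup p F G (put (p.+1 + j) v x) = act (hat p.+1 F x) (G (put j v (shift p.+1 x))).
Proof.
congr act; last first.
  by apply: (sesq_ext sG) => k; rewrite /shift /put eqn_add2l.
have E k : (k <= p)%N -> put (p.+1 + j) v x k = x k by rewrite /put; case: eqP => //; lia.
congr pair; first by apply: eq_label => k; rewrite ltnS => /E.
by apply: (sesq_loc sF) => [k /ltnW/E //|]; rewrite E.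
Qed.

Lemma sesq_scup : sesq (p + q.+1) (scup p F G).
Proof.
split.
- move=> x y e e'; congr act.
    congr pair; first by apply: eq_label => k lt_kp; apply: e; lia.
    by apply: (sesq_loc sF) => [k lt_kp|]; rewrite e //; lia.
  apply: (sesq_loc sG) => [k lt_kq|]; first by apply: e; lia.
  by rewrite /shift addSnnS.
- move=> x j t c a b le_jn; have [le_jp|lt_pj] := leqP j p.
    rewrite !scup_putl // /hat (sesq_lin sF) // /act /= lprodvDl.
    by congr (_ *: lprodv _ _ _ + lprodv _ _ _); apply: label_put.
  rewrite -(subnKC lt_pj) !scup_putr (sesq_lin sG) ?linearP //; lia.
- move=> x j lt_jn; have [lt_jp|lt_pj|->] := ltngtP j p.
  + by rewrite scup_putl ?(ltnW lt_jp) // /hat (sesq_kill sF) // /act lprodv0l.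
  + rewrite -(subnKC lt_pj) scup_putr (sesq_kill sG) ?linear0 //; lia.
  (* Entry p is the last one of F but an inner one of the product. *)
  + by rewrite scup_putl // hat_put_pdel // act_pdel.
- move=> x; rewrite -addSnnS scup_putr.
  have -> : x (p.+1 + q)%N = shift p.+1 x q by [].
  rewrite (sesq_last sG) -[X in act _ X]/(pdel (label (shift p.+1 x) q.+1, _)).2.
  by rewrite act_pdelr /= -label_add addnS.
Qed.

(** The Leibniz rule: the equation of F is multiplied by G on the right, that of G by F on the left,
    and the terms are matched. *)
Lemma dstream_scup :
  (forall x, dstream p.+1 F x = 0) -> (forall x, dstream q.+1 G x = 0) ->
  forall x, dstream (p + q.+1).+1 (scup p F G) x = 0.
Proof.
move=> dF dG x.
pose K a := lprodv (label x p.+2) a (G (shift p.+2 x)).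
pose Klin := GRing.isLinear.Build C A A *:%R K
  (fun c a b => lprodvDl (label x p.+2) (G (shift p.+2 x)) c a b).
pose KK : {linear A -> A} := HB.pack K Klin.
pose LL : {linear A -> A} := act (hat p.+1 F x).
have := congr1 KK (dF x).
rewrite (linear0 KK) /dstream !(linearD KK) (linear_sum KK) (linearZ_LR KK).
have := congr1 LL (dG (shift p.+1 x)).
rewrite (linear0 LL) /dstream !(linearD LL) (linear_sum LL) (linearZ_LR LL).
rewrite (@big_cat_nat _ _ _ p.+1 0 (p + q.+1).+1) //; last by lia.
have -> : \sum_(0 <= k < p.+1) (-1) ^+ k.+1 *: scup p F G (face k x) =
    \sum_(0 <= k < p.+1) KK ((-1) ^+ k.+1 *: F (face k x)).
  apply: eq_big_nat => k /andP[_ lt_kp]; rewrite (linearZ_LR KK); congr (_ *: _).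
  rewrite /scup /hat label_face //; congr lprodv.
  apply: (sesq_ext sG) => j; rewrite /shift /face.
  by do ?case: ifP => // ?; try lia; congr (x _); lia.
have -> : \sum_(p.+1 <= k < (p + q.+1).+1) (-1) ^+ k.+1 *: scup p F G (face k x) =
    (-1) ^+ p.+1 *: \sum_(0 <= k < q.+1) LL ((-1) ^+ k.+1 *: G (face k (shift p.+1 x))).
  rewrite scaler_sumr -{1}[p.+1]add0n big_addn (_ : ((p + q.+1).+1 - p.+1 = q.+1)%N); last lia.
  apply: eq_bigr => k _; rewrite (linearZ_LR LL) scalerA -exprD.
  congr (_ ^+ _ *: _); first lia.
  congr act.
    have E j : (j <= p)%N -> face (k + p.+1) x j = x j by rewrite /face; case: ifP => //; lia.
    congr pair; first by apply: eq_label => j; rewrite ltnS => /E.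
    by apply: (sesq_loc sF) => [j /ltnW/E //|]; rewrite E.
  apply: (sesq_ext sG) => j; rewrite /shift /face.
  by do ?case: ifP => // ?; try lia; do ?congr pmul; congr (x _); lia.
have -> : act (x 0%N) (scup p F G (shift 1 x)) =
    KK (act (x 0%N) (F (shift 1 x))).
  by rewrite -[RHS]/(K _) /K label_shift1 /scup -actA.
have -> : act (hat (p + q.+1).+1 (scup p F G) x) (x (p + q.+1).+1).2 =
    LL (act (hat q.+1 G (shift p.+1 x)) (shift p.+1 x q.+1).2).
  by rewrite /= -actA /pmul /= -label_add addSn.
(* By associativity the last term of dF times G equals F times the first term of dG. They enter with
   opposite signs and are no part of the coboundary of the product. *)
have -> : LL (act (shift p.+1 x 0%N) (G (shift 1 (shift p.+1 x)))) =
    KK (act (hat p.+1 F x) (x p.+1).2).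
  rewrite /= -actA /K labelS /shift /pmul /= addn0; congr lprodv.
  by apply: (sesq_ext sG) => j; congr (x _); lia.
set U := \sum_(0 <= k < q.+1) _; set Z := KK (act (hat _ _ _) _).
set W := LL _; set S := \sum_(0 <= k < p.+1) _; set T := KK _.
move=> eL eK.
have -> : U = - Z - (-1) ^+ q.+2 *: W.
  by rewrite -[RHS]addr0 -eL addrACA addNr addr0 addrA addNr add0r.
have -> : T + (S + (-1) ^+ p.+1 *: (- Z - (-1) ^+ q.+2 *: W)) =
    T + S + (-1) ^+ p.+2 *: Z + (-1) ^+ (p + q.+1).+1 *: W.
  rewrite scalerBr scalerN scalerA -exprD -scaleNr -mulN1r -exprS !addrA.
  congr (_ + _); rewrite -scaleNr -mulN1r -exprS !addnS addSn.
  by rewrite [in LHS]exprS [in LHS]exprS !mulN1r opprK.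
by rewrite eK add0r -scalerDl [X in _ + X]exprS mulN1r subrr scale0r.
Qed.

Section Composition.
Variables (i : nat) (le_ip : (i <= p)%N).

Lemma scomp_putl j v x : (j < i)%N ->
  scomp i F q G (put j v x) = F (put j v (ins i q (hat q.+1 G (shift i x)) x)).
Proof.
move=> lt_ji; have E : shift i (put j v x) =1 shift i x.
  by move=> k; rewrite /shift /put; case: eqP => //; lia.
rewrite /scomp /hat (sesq_ext sG E) (eq_label (fun k _ => E k)).
apply: (sesq_ext sF) => k; rewrite /ins /put.
by do ?case: ifP => // ?; lia.
Qed.

Lemma scomp_putm j v x : (j <= q)%N ->
  scomp i F q G (put (i + j) v x) =
  F (ins i q (hat q.+1 G (put j v (shift i x))) x).
Proof.
move=> le_jq; have E : shift i (put (i + j) v x) =1 put j v (shift i x).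
  by move=> k; rewrite /shift /put eqn_add2l.
rewrite /scomp /hat (sesq_ext sG E) (eq_label (fun k _ => E k)).
apply: (sesq_ext sF) => k; rewrite /ins /put.
by do ?case: ifP => // ?; lia.
Qed.

Lemma scomp_putr j v x : (i < j)%N ->
  scomp i F q G (put (j + q) v x) = F (put j v (ins i q (hat q.+1 G (shift i x)) x)).
Proof.
move=> lt_ij.
have E k : (k <= q)%N -> shift i (put (j + q) v x) k = shift i x k.
  by move=> le_kq; rewrite /shift /put; case: eqP => //; lia.
have -> : scomp i F q G (put (j + q) v x) =
    F (ins i q (hat q.+1 G (shift i x)) (put (j + q) v x)).
  congr (F (ins i q (_, _) _)); first by apply: eq_label => k; rewrite ltnS => /E.
  by apply: (sesq_loc sG) => [k /ltnW/E //|]; rewrite E.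
apply: (sesq_ext sF) => k; rewrite /ins /put.
by do ?case: ifP => // ?; lia.
Qed.

Let ins_put v w x : F (ins i q v x) = F (put i v (ins i q w x)).
Proof.
by apply: (sesq_ext sF) => k; rewrite /ins /put; do ?case: ifP => // ?; lia.
Qed.

Let ins_i v x : ins i q v x i = v.
Proof. by rewrite /ins ltnn eqxx. Qed.

Lemma sesq_scomp : sesq (p + q) (scomp i F q G).
Proof.
split.
(* For i = p the last label of G may differ between x and y, so only the vectors agree; that is
   enough, as F does not see the label of entry p. *)
- move=> x y e e'; have E : hat q.+1 G (shift i x) = hat q.+1 G (shift i y) \/ (p <= i)%N
      /\ G (shift i x) = G (shift i y).
    have EG : G (shift i x) = G (shift i y).
      apply: (sesq_loc sG) => [k lt_kq|]; first by apply: e; lia.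
      have [lt_ip|le_pi] := ltnP i p; first by rewrite /shift e //; lia.
      by rewrite /shift (_ : (i + q = p + q)%N) //; lia.
    have [lt_ip|le_pi] := ltnP i p; [left|by right].
    by congr pair => //; apply: eq_label => k lt_kq; apply: e; lia.
  apply: (sesq_loc sF) => [j lt_jp|].
    case: E => [->|[le_pi _]].
      by rewrite /ins; do ?case: ifP => // ?; apply: e; lia.
    by rewrite /ins; case: ifP => ?; [apply: e|]; lia.
  have EG : G (shift i x) = G (shift i y) by case: E => [[] _|[]].
  rewrite /ins; case: ifP => [?|_]; first by lia.
  by case: eqP => _; [exact: EG | exact: e'].
- move=> x j t c a b le_jn.
  have [lt_ji|le_ij] := ltnP j i.
    by rewrite !scomp_putl // (sesq_lin sF) //; lia.
  have [le_jq|lt_iqj] := leqP j (i + q).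
    have -> : j = (i + (j - i))%N by lia.
    have le_q : (j - i <= q)%N by lia.
    rewrite !scomp_putm // /hat (sesq_lin sG) // (@ins_linear _ _ p i q F) //.
    by rewrite !(label_put _ _ _ (c *: a + b) 0) (label_put _ _ _ a 0) (label_put _ _ _ b 0).
  have -> : j = (j - q + q)%N by lia.
  by rewrite !scomp_putr ?(sesq_lin sF) //; lia.
- move=> x j lt_jn.
  have [lt_ji|le_ij] := ltnP j i.
    rewrite scomp_putl //.
    have -> : x j = ins i q (hat q.+1 G (shift i x)) x j by rewrite /ins lt_ji.
    by rewrite (sesq_kill sF) //; lia.
  have [le_jq|lt_iqj] := leqP j (i + q).
    have -> : j = (i + (j - i))%N by lia.
    have le_q : (j - i <= q)%N by lia.
    rewrite scomp_putm //; have -> : x (i + (j - i))%N = shift i x (j - i) by [].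
    have [lt_q|le_q'] := ltnP (j - i) q.
      rewrite /hat (sesq_kill sG) //.
      set t := label _ _.
      (* F vanishes at a zero vector, by additivity at 0 + 0. *)
      have := @ins_linear _ _ p i q F x 0 0 t 1 sF le_ip.
      rewrite scale1r addr0 scale1r => /esym/(canRL (addrK _)) ->; exact: subrr.
    have -> : (j - i)%N = q by lia.
    rewrite hat_put_pdel // (ins_put _ (hat q.+1 G (shift i x))).
    rewrite -{1}(ins_i (hat q.+1 G (shift i x)) x) (sesq_kill sF) //; lia.
  have -> : j = (j - q + q)%N by lia.
  rewrite scomp_putr; last lia.
  have -> : x (j - q + q)%N = ins i q (hat q.+1 G (shift i x)) x (j - q).
    by rewrite /ins; do ?case: ifP => // ?; lia.
  by rewrite (sesq_kill sF) //; lia.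
- move=> x.
  have lbl : label (ins i q (hat q.+1 G (shift i x)) x) p.+1 = label x (p + q).+1.
    exact: label_ins.
  have [lt_ip|le_pi] := ltnP i p.
    rewrite scomp_putr //.
    have -> : x (p + q)%N = ins i q (hat q.+1 G (shift i x)) x p.
      by rewrite /ins; do ?case: ifP => // ?; lia.
    by rewrite (sesq_last sF) lbl.
  (* G sits in the last entry of F: d + t passes first through G, then through F. *)
  have ei : i = p by lia.
  have sF' : sesq i F by rewrite ei.
  rewrite -ei in lbl *; rewrite scomp_putm //; have -> : x (i + q)%N = shift i x q by [].
  rewrite hat_put_pdel // (ins_put _ (hat q.+1 G (shift i x))).
  by rewrite -{1}(ins_i (hat q.+1 G (shift i x)) x) (sesq_last sF') lbl.
Qed.

End Composition.
End Closure.
End StreamCochains.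

(** * Evaluation of cochains *)

Section Bridge.
Variables (C : fieldType) (charC : [pchar C] =i pred0) (A : assocConfAlg C).
Local Notation point := (C * A)%type.
Implicit Types (x y : nat -> point).

Definition eval_cochain n (phi : cochain A n.+1) x : A :=
  ev (fun j : 'I_n => (x j).1) (phi [ffun j : 'I_n.+1 => (x j).2]).

Lemma eval_ext n (phi : cochain A n.+1) x y :
  x =1 y -> eval_cochain phi x = eval_cochain phi y.
Proof.
move=> e; rewrite /eval_cochain (eq_ev _ (fun j : 'I_n => congr1 fst (e j))).
by congr (ev _ (phi _)); apply/ffunP => j; rewrite !ffunE e.
Qed.

(** A section of the passage from streams to arguments and values of the variables; outside the
    range the choices are arbitrary. *)
Definition stream_of n (a : {ffun 'I_n.+1 -> A}) (l : 'I_n -> C) (j : nat) : point :=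
  (if insub j is Some i then l i else 0, a (inord j)).

Lemma stream_of_snd n (a : {ffun 'I_n.+1 -> A}) l :
  [ffun j : 'I_n.+1 => (stream_of a l j).2] = a.
Proof. by apply/ffunP => j; rewrite ffunE /= inord_val. Qed.

Lemma stream_of_fst n (a : {ffun 'I_n.+1 -> A}) l (j : 'I_n) :
  (stream_of a l j).1 = l j.
Proof. by rewrite /stream_of /= valK. Qed.

Lemma eval_stream_of n (phi : cochain A n.+1) a l :
  eval_cochain phi (stream_of a l) = ev l (phi a).
Proof.
rewrite /eval_cochain stream_of_snd; apply: eq_ev => j.
exact: stream_of_fst.
Qed.

Lemma eval_cochain_inj n (phi psi : cochain A n.+1) :
  eval_cochain phi =1 eval_cochain psi -> forall a, phi a = psi a.
Proof.
move=> e a; apply: (ev_inj charC) => l.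
by rewrite -!eval_stream_of e.
Qed.

Lemma eval_put n (phi : cochain A n.+1) (j : 'I_n.+1) v x :
  eval_cochain phi (put j ((x j).1, v) x) =
  ev (fun k : 'I_n => (x k).1) (phi (upd [ffun k : 'I_n.+1 => (x k).2] j v)).
Proof.
have -> : upd [ffun k : 'I_n.+1 => (x k).2] j v =
    [ffun k : 'I_n.+1 => (put j ((x j).1, v) x k).2].
  by apply/ffunP => k; rewrite !ffunE /put val_eqE; case: eqP.
by apply: eq_ev => k; rewrite /put; case: eqP => // ->.
Qed.

Lemma updE n (a : {ffun 'I_n -> A}) i : upd a i (a i) = a.
Proof. by apply/ffunP => k; rewrite ffunE; case: eqP => // ->. Qed.

Lemma sesq_eval n (phi : cochain A n.+1) :
  sesquilinear phi -> sesq n (eval_cochain phi).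
Proof.
move=> [lin dl dlast].
have evlin l a i c u v :
    ev l (phi (upd a i (c *: u + v))) = c *: ev l (phi (upd a i u)) + ev l (phi (upd a i v)).
  by apply: etrans (congr1 _ (lin _ _ _ _ _)) _; rewrite evD evZ pevC.
have updD l a i t : ev l (phi (upd a i (del (a i) + t *: a i))) =
    t *: ev l (phi a) + ev l (phi (upd a i (del (a i)))).
  by rewrite addrC evlin updE.
split.
- move=> x y e e'; rewrite /eval_cochain.
  have -> : [ffun j : 'I_n.+1 => (x j).2] = [ffun j : 'I_n.+1 => (y j).2].
    apply/ffunP => j; rewrite !ffunE; have := leq_ord j; rewrite leq_eqVlt.
    by case/orP => [/eqP -> //|/e ->].
  by apply: eq_ev => j; rewrite e.
- move=> x j t c a b le_jn; pose z := put j (t, 0) x.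
  pose jj := Ordinal (le_jn : (j < n.+1)%N).
  have E v : eval_cochain phi (put j (t, v) x) =
      ev (fun k : 'I_n => (z k).1) (phi (upd [ffun k : 'I_n.+1 => (z k).2] jj v)).
    rewrite -eval_put; apply: eval_ext => k; rewrite /z /put /= eqxx.
    by case: eqP.
  by rewrite !E evlin.
- move=> x j lt_jn; pose jj := Ordinal lt_jn.
  have := eval_put phi (wid jj) ((pdel (x j)).2) x => /= ->.
  have -> : del (x j).2 + (x j).1 *: (x j).2 =
     let a := [ffun k : 'I_n.+1 => (x k).2] in del (a (wid jj)) + (x j).1 *: a (wid jj).
    by rewrite /= ffunE.
  rewrite updD.
  have := congr1 (ev (fun k : 'I_n => (x k).1)) (dl [ffun k : 'I_n.+1 => (x k).2] jj).
  rewrite evZ rmorphN /= pev_lvar => ->.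
  by rewrite scaleNr subrr.
- move=> x; have := eval_put phi ord_max ((pdel (x n)).2) x => /= ->.
  have -> : del (x n).2 + (x n).1 *: (x n).2 =
     let a := [ffun k : 'I_n.+1 => (x k).2] in del (a ord_max) + (x n).1 *: a ord_max.
    by rewrite /= ffunE.
  rewrite updD.
  have := congr1 (ev (fun k : 'I_n => (x k).1)) (dlast [ffun k : 'I_n.+1 => (x k).2]).
  rewrite evD ev_map_vpoly evZ rmorph_sum /= => ->.
  under eq_bigr do rewrite pev_lvar.
  rewrite labelS /label big_mkord scalerDl addrC -addrA; congr (_ + (_ + _)).
Qed.

(** Cochains constructed later are known through their values; this spares checking sesquilinearity
    on their polynomial formulas. *)
Lemma eval_sesq n (phi : cochain A n.+1) :
  sesq n (eval_cochain phi) -> sesquilinear phi.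
Proof.
move=> sphi.
have E a l i v : ev l (phi (upd a i v)) =
    eval_cochain phi (put i ((stream_of a l i).1, v) (stream_of a l)).
  rewrite eval_put stream_of_snd; apply: eq_ev => k.
  exact/esym/stream_of_fst.
have put_id k x : put k (x k) x =1 x by move=> j; rewrite /put; case: eqP => // ->.
have lin a l i c u v :
    ev l (phi (upd a i (c *: u + v))) = c *: ev l (phi (upd a i u)) + ev l (phi (upd a i v)).
  by rewrite !E (sesq_lin sphi) // -ltnS.
have updD a l i t : ev l (phi (upd a i (del (a i) + t *: a i))) =
    t *: ev l (phi a) + ev l (phi (upd a i (del (a i)))).
  by rewrite addrC lin updE.
have snd a l (i : 'I_n.+1) : (stream_of a l i).2 = a i by rewrite /= inord_val.
split.
- move=> a i c u v; apply: (ev_inj charC) => l; rewrite lin.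
  by apply: esym; apply: etrans (evD _ _ _) _; rewrite evZ pevC.
- move=> a i; apply: (ev_inj charC) => l.
  have := sesq_kill sphi (stream_of a l) (ltn_ord i).
  (* [put] takes a natural number and [upd] an ordinal; the position is displayed as the value of
     [wid i] for [E] to match. *)
  rewrite /pdel -[X in put X]/(nat_of_ord (wid i)).
  rewrite -[X in del (stream_of a l X).2]/(nat_of_ord (wid i)).
  rewrite -[X in _ *: (stream_of a l X).2]/(nat_of_ord (wid i)) snd.
  rewrite -[X in (X, _)]/((stream_of a l (wid i)).1) -E updD.
  rewrite evZ rmorphN /= pev_lvar scaleNr => /eqP; rewrite addrC addr_eq0 => /eqP ->.
  by congr (- (_ *: _)); apply: (stream_of_fst a l i).
- move=> a; apply: (ev_inj charC) => l.
  have := sesq_last sphi (stream_of a l).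
  rewrite /pdel -[X in put X]/(nat_of_ord (@ord_max n)).
  rewrite -[X in del (stream_of a l X).2]/(nat_of_ord (@ord_max n)).
  rewrite -[X in _ *: (stream_of a l X).2]/(nat_of_ord (@ord_max n)) snd.
  rewrite -[X in (X, _)]/((stream_of a l (@ord_max n)).1) -E updD.
  rewrite eval_stream_of labelS scalerDl => e.
  apply: esym; apply: etrans (evD _ _ _) _.
  rewrite ev_map_vpoly evZ rmorph_sum /=.
  apply: (addrI ((stream_of a l n).1 *: ev l (phi a))); rewrite e.
  rewrite addrC -addrA; congr (_ + (_ *: _ + _)).
  rewrite /label big_mkord; apply: eq_bigr => k _; rewrite pev_lvar.
  exact/esym/stream_of_fst.
Qed.

Lemma ev_subst n m (l : 'I_n -> C) (l' : 'I_m -> C) s (P : vpoly A m) :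
  (forall i, pev l (s i) = l' i) -> ev l (psubst s P) = ev l' P.
Proof. by move=> e; rewrite ev_psubst; apply: eq_ev. Qed.

Lemma ev_lprod n (l : 'I_n -> C) q (P Q : vpoly A n) :
  ev l (lprod q P Q) = lprodv (pev l q) (ev l P) (ev l Q).
Proof. by rewrite lprodvE; apply: ev_lprod_of => *; rewrite ?lmulPl ?lmulPr. Qed.

(** The substitution [merge_var i] evaluates to the labels of [face i], and linearity in entry i
    collapses the sum over the coefficients of the product. *)
Lemma eval_diff n (phi : cochain A n.+1) x : sesquilinear phi ->
  eval_cochain (diff phi : cochain A n.+2) x = dstream n.+1 (eval_cochain phi) x.
Proof.
move=> sphi; set l := fun j : 'I_n.+1 => (x j).1.
rewrite /eval_cochain -/l /= /diffS; set a := [ffun j : 'I_n.+2 => (x j).2].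
apply: etrans (evD _ _ _) _; congr (_ + _).
  apply: etrans (evD _ _ _) _; congr (_ + _).
    apply: etrans (ev_lprod _ _ _ _) _; rewrite pev_lvar evC /a ffunE.
    congr (lprodv _ _ _); rewrite (ev_subst (l' := fun j => (shift 1 x j).1)).
      by congr (ev _ (phi _)); apply/ffunP => j; rewrite !ffunE.
    by move=> j; rewrite pev_lvar.
  rewrite raddf_sum big_mkord; apply: eq_bigr => i _.
  apply: etrans (evZ _ _ _) _; congr (_ *: _); first by rewrite rmorphXn rmorphN1.
  rewrite /merge_term raddf_sum.
  pose L v := phi [ffun j => if j == i then v else a (lift (lift ord0 i) j)].
  have Llin c u v : L (c *: u + v) = c%:MP *: L u + L v.
    have EL w : L w = phi (upd [ffun j => a (lift (lift ord0 i) j)] i w).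
      by congr (phi _); apply/ffunP => j; rewrite !ffunE.
    by rewrite !EL (sesq_linear sphi).
  have := ev_linear (fun=> l i) (fun j : 'I_n => (face i x j).1)
    (lmul (a (wid i)) (a (lift ord0 i))) Llin.
  rewrite /L -lprodvE => e; apply: etrans _ (etrans e _).
    apply: eq_bigr => u _; apply: etrans (evZ _ _ _) _.
    rewrite big_ord1 rmorphXn /= pev_lvar; congr (_ *: _).
    apply: ev_subst => j; rewrite /merge_var /face.
    have [lt_ji|_] := ifPn; first by rewrite pev_lvar.
    have [/eqP ji|_] := ifPn; last by rewrite pev_lvar.
    apply: etrans (pevD _ _ _) _; rewrite -[RHS]/((x i).1 + (x i.+1).1) -ji.
    by congr (_ + _); exact: pev_lvar.
  congr (ev _ (phi _)); apply/ffunP => j; rewrite !ffunE /face.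
  have [->|ne_ji] := eqVneq j i; first by rewrite ltnn eqxx.
  rewrite -val_eqE /= in ne_ji; rewrite (negPf ne_ji) /= /bump /=.
  by case: ifP => lt_ji; congr (x _).2; lia.
apply: etrans (evZ _ _ _) _; congr (_ *: _); first by rewrite rmorphXn rmorphN1.
apply: etrans (ev_lprod _ _ _ _) _; rewrite evC rmorph_sum /= /act /hat /=.
congr lprodv; last by rewrite /a ffunE.
  by rewrite /label big_mkord; apply: eq_bigr => j _; rewrite pev_lvar.
rewrite (ev_subst (l' := fun j => (x j).1)); last by move=> j; rewrite pev_lvar.
by congr (ev _ (phi _)); apply/ffunP => j; rewrite !ffunE.
Qed.

End Bridge.

(** * Cup products in positive degrees *)

Section Cup.
Variables (C : fieldType) (charC : [pchar C] =i pred0) (A : assocConfAlg C).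
Local Notation point := (C * A)%type.
Implicit Types (x y : nat -> point).

Lemma cocycle_eval n (phi : cochain A n.+1) : cocycle phi ->
  sesq n (eval_cochain phi) /\ forall x, dstream n.+1 (eval_cochain phi) x = 0.
Proof.
move=> [sphi dphi]; split=> [|x]; first exact: sesq_eval.
by rewrite -eval_diff // /eval_cochain dphi ev0.
Qed.

Lemma eval_cocycle n (phi : cochain A n.+1) :
  sesq n (eval_cochain phi) ->
  (forall x, dstream n.+1 (eval_cochain phi) x = 0) -> cocycle phi.
Proof.
move=> sphi dphi; have sphi' := eval_sesq charC sphi; split=> // a.
apply: (@eval_cochain_inj _ charC _ _ (diff phi) (fun=> 0)) => x.
by rewrite eval_diff // dphi /eval_cochain ev0.
Qed.

Lemma eval_cupSS m n (f : cochain A m.+1) (g : cochain A n.+1) x :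
  @eval_cochain _ _ (m + n.+1) (cupSS f g) x =
  scup m (eval_cochain f) (eval_cochain g) x.
Proof.
apply: etrans (ev_lprod _ _ _ _) _; rewrite /scup /act /hat /=.
congr lprodv.
- rewrite rmorph_sum /= /label.
  rewrite (big_nat_widen _ _ (m + n.+1)); last by lia.
  by rewrite big_mkord; apply: eq_bigr => i _; rewrite pev_lvar.
- apply: etrans (ev_subst (l' := fun j => (x j).1) _ _) _.
    by move=> j; rewrite pev_lvar.
  by congr (ev _ (f _)); apply/ffunP => j; rewrite !ffunE.
- apply: etrans (ev_subst (l' := fun j => (shift m.+1 x j).1) _ _) _.
    by move=> j; rewrite pev_lvar /shift /= /bump /= addnA addn1.
  by congr (ev _ (g _)); apply/ffunP => j; rewrite !ffunE.
Qed.

Lemma eval_ccast n m (e : n.+1 = m.+1) (phi : cochain A n.+1) x :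
  eval_cochain (ccast e phi) x = eval_cochain phi x.
Proof. by case: (e) => e'; case: m / e' e => e; rewrite (eq_axiomK e). Qed.

(** Indices are natural numbers so that shifted variables can be written without bound proofs;
    [pev_nvar] asks for the bound only on evaluation. *)
Definition nvar m k : {mpoly C[m]} := if insub k is Some i then lvar i else 0.

Lemma pev_nvar m k (l : nat -> C) : (k < m)%N ->
  pev (fun i : 'I_m => l i) (nvar m k) = l k.
Proof. by move=> lt_km; rewrite /nvar insubT pev_lvar. Qed.

(** A function of streams need not be polynomial, so f o_i g is given by a formula: the coefficients
    of g are fed into entry i of f one at a time. *)
Lemma comp_cochain p q i (f : cochain A p.+1) (g : cochain A q.+1) :
  sesquilinear f -> (i <= p)%N ->
  exists h : cochain A (p + q).+1,
    eval_cochain h =1 scomp i (eval_cochain f) q (eval_cochain g).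
Proof.
move=> sf le_ip; pose N := (p + q)%N.
(* Variable i of f becomes the total of the q + 1 labels entering g, and later variables move by q.
   For i = p the middle case does not arise, since f has no variable for its last entry. *)
pose s (j : 'I_p) : {mpoly C[N]} :=
  if (j < i)%N then nvar N j
  else if j == i :> nat then \sum_(0 <= k < q.+1) nvar N (i + k)
  else nvar N (j + q).
(* The labels 0 are dummies, as only vectors are read off. *)
pose L (a : {ffun 'I_N.+1 -> A}) v := f [ffun j : 'I_p.+1 =>
  (ins i q (0, v) (fun k => (0, a (inord k))) j).2].
have Llin a c u v : L a (c *: u + v) = c%:MP *: L a u + L a v.
  have E w : L a w = f (upd [ffun j : 'I_p.+1 =>
      (ins i q (0, 0) (fun k => (0, a (inord k))) j).2] (Ordinal (le_ip : (i < p.+1)%N)) w).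
    congr (f _); apply/ffunP => j; rewrite !ffunE /ins -val_eqE /=.
    by case: ltngtP.
  by rewrite !E (sesq_linear sf).
pose h (a : {ffun 'I_N.+1 -> A}) : vpoly A N :=
  let Q : vpoly A q := g [ffun j : 'I_q.+1 => a (inord (i + j))] in
  \sum_(w <- msupp Q) (\prod_(j < q) nvar N (i + j) ^+ w j) *: psubst s (L a Q@_w).
exists h => x.
set a := [ffun j : 'I_N.+1 => (x j).2].
have aE k : (k <= N)%N -> a (inord k) = (x k).2 by move=> le_kN; rewrite ffunE inordK.
pose l' (j : 'I_p) := (ins i q (label (shift i x) q.+1, 0) x j).1.
rewrite /eval_cochain -/a /h raddf_sum.
have := ev_linear (fun j : 'I_q => (x (i + j)%N).1) l'
  (g [ffun j : 'I_q.+1 => a (inord (i + j))]) (Llin a) => e.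
apply: etrans _ (etrans e _).
  apply: eq_bigr => w _; apply: etrans (evZ _ _ _) _.
  congr (_ *: _).
    rewrite rmorph_prod; apply: eq_bigr => j _; rewrite rmorphXn /=.
    by rewrite (pev_nvar (fun k => (x k).1)) // /N; have := ltn_ord j; lia.
  apply: ev_subst => j; rewrite /s /l' /ins; have lt_jp := ltn_ord j.
  have [lt_ji|_] := ifPn.
    by rewrite (pev_nvar (fun k => (x k).1)) // /N; lia.
  have [/eqP ji|_] := ifPn; last first.
    by rewrite (pev_nvar (fun k => (x k).1)) // /N; lia.
  rewrite rmorph_sum; apply: eq_big_nat => k /andP[_ lt_kq] /=.
  by rewrite (pev_nvar (fun k => (x k).1)) // /N; lia.
have -> : ev (fun j : 'I_q => (x (i + j)%N).1) (g [ffun j : 'I_q.+1 => a (inord (i + j))]) =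
    eval_cochain g (shift i x).
  congr (ev _ (g _)); apply/ffunP => j; rewrite !ffunE inordK //.
  by have := ltn_ord j; rewrite /N; lia.
pose l j := (ins i q (hat q.+1 (eval_cochain g) (shift i x)) x j).1.
rewrite /scomp /L; apply: etrans (eq_ev (l' := fun j : 'I_p => l j) _ _) _.
  by move=> j; rewrite /l' /l /ins; case: ifP => //; case: ifP.
congr (ev _ (f _)); apply/ffunP => j; rewrite !ffunE /ins; have le_jp := leq_ord j.
case: ifP => ?; first by rewrite aE // /N; lia.
case: ifP => ? //; rewrite aE // /N; lia.
Qed.

Lemma sum_cochain n m (c : nat -> C) (F : nat -> (nat -> point) -> A) :
  (forall i, (i < m)%N -> exists h : cochain A n.+1, eval_cochain h =1 F i) ->
  exists h : cochain A n.+1,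
    forall x, eval_cochain h x = \sum_(0 <= i < m) c i *: F i x.
Proof.
elim: m => [|m IHm] H.
  by exists (fun=> 0) => x; rewrite big_geq // /eval_cochain ev0.
have [h1 E1] := IHm (fun i lt_im => H i (ltnW lt_im)).
have [h2 E2] := H m (ltnSn m).
exists (fun a => h1 a + (c m)%:MP *: h2 a) => x.
rewrite big_nat_recr //= -E1 -E2; apply: etrans (evD _ _ _) _.
by congr (_ + _); apply: etrans (evZ _ _ _) _; rewrite pevC.
Qed.

(** The equation [e] is carried because p + q.+1 does not reduce to a successor, which [diff] must
    see to compute. *)
Lemma coboundary_eval k N (e : k.+1 = N) (h : cochain A k.+1) (f g : cochain A N.+1) :
  sesq k (eval_cochain h) ->
  (forall x, eval_cochain f x - eval_cochain g x = dstream k.+1 (eval_cochain h) x) ->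
  coboundary f g.
Proof.
case: N / e f g => f g sh E; exists h; first exact: eval_sesq.
apply: (@eval_cochain_inj _ charC _ _ (fun a => f a - g a)) => x.
rewrite eval_diff; last exact: eval_sesq.
by rewrite -E; apply: raddfB.
Qed.

Lemma cup_comm_pos p q (f : cochain A p.+1) (g : cochain A q.+1) :
  cocycle f -> cocycle g ->
  HH_eq (ccast (addnC q.+1 p.+1) (cup g f)) (cscale ((-1) ^+ (p.+1 * q.+1)) (cup f g)).
Proof.
move=> /cocycle_eval[sf df] /cocycle_eval[sg dg].
set F := ccast _ _; set c := (-1) ^+ _; set G := cscale _ _.
have EF x : @eval_cochain _ _ (p + q.+1) F x =
    scup q (eval_cochain g) (eval_cochain f) x.
  by apply: etrans (@eval_ccast (q + p.+1) (p + q.+1) _ _ _) _; apply: eval_cupSS.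
have EG x : @eval_cochain _ _ (p + q.+1) G x =
    c *: scup p (eval_cochain f) (eval_cochain g) x.
  by apply: etrans (evZ _ _ _) _; rewrite pevC -eval_cupSS.
(* Gerstenhaber's signs, normalised so that g cup f has coefficient 1. *)
pose d i : C := - (-1) ^+ q * (-1) ^+ (i * q).
have [h Eh] := sum_cochain d (fun i (lt_ip : (i < p.+1)%N) =>
  comp_cochain g (eval_sesq charC sf) lt_ip).
have sFG : sesq (p + q.+1) (scup q (eval_cochain g) (eval_cochain f)).
  by rewrite addnS addnC -addnS; apply: sesq_scup.
split.
- apply: (@eval_cocycle (p + q.+1)).
    by apply: eq_sesq sFG => x; rewrite EF.
  move=> x; rewrite (eq_dstream _ _ EF).
  by rewrite (_ : (p + q.+1).+1 = (q + p.+1).+1); [apply: dstream_scup | lia].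
- apply: (@eval_cocycle (p + q.+1)).
    apply: (@eq_sesq _ _ _ (fun x => c *: scup p (eval_cochain f) (eval_cochain g) x + 0)).
      by move=> x; rewrite EG addr0.
    by apply: sesq_lincomb; [apply: sesq_scup | apply: sesq0].
  (* As a sum with one term, so that [dstream_sum] pulls out the scalar. *)
  move=> x; rewrite (@eq_dstream _ _ _ _ (fun x => \sum_(0 <= i < 1)
    c *: scup p (eval_cochain f) (eval_cochain g) x)); last first.
    by move=> y; rewrite big_nat1 EG.
  by rewrite (dstream_sum _ _ (fun=> c)) big_nat1 dstream_scup ?scaler0.
- apply: (@coboundary_eval (p + q) (p + q.+1) (esym (addnS p q)) h).
    apply: (@eq_sesq _ _ _ (fun x => \sum_(0 <= i < p.+1)
        d i *: scomp i (eval_cochain f) q (eval_cochain g) x)).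
      by move=> x; rewrite Eh.
    by apply: sesq_sum => i lt_ip; apply: sesq_scomp.
  move=> x; rewrite EF EG (eq_dstream _ _ Eh) dstream_sum.
  under eq_bigr do rewrite -scalerA.
  rewrite -scaler_sumr gerstenhaber // scalerBr !scalerA mulNr mulrN opprK.
  rewrite -expr2 sqrr_sign scale1r mulNr scaleNr opprK -exprD.
  rewrite -scaleNr /c -mulN1r -exprS; congr (_ + _ *: _).
  rewrite (_ : (p.+1 * q.+1).+1 = (q + (p * q + p)).+2); last lia.
  by rewrite !exprS !mulN1r opprK.
Qed.

End Cup.

(** * Cocycles of degree zero *)

Section DegreeZero.
Variables (C : fieldType) (charC : [pchar C] =i pred0) (A : assocConfAlg C).
Local Notation point := (C * A)%type.
Implicit Types (x y : nat -> point) (v w : A).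

(** The constant coefficient of a polynomial is its value at 0. *)
Lemma zero_prodE v (a : A) : zero_prod v a = lprodv 0 v a.
Proof.
rewrite lprodvE /zero_prod.
pose f (P : {mpoly A[1]}) := mcoeff (mone : 'X_{1..1}) P.
pose g (P : {mpoly A[1]}) : A := ev (fun=> 0) P.
apply: (malg_eq (f := f) (g := g)) => [P Q|P Q|u c]; [exact: mcoeffD|exact: evD|].
apply: etrans (mcoeffU _ _ _) (esym _); apply: etrans (evU _ _ _) _.
rewrite big_ord1 expr0n scaler_nat; congr (_ *+ nat_of_bool _).
apply/eqP/cmP => [u0 i|->]; last by rewrite cm1.
by rewrite cm1 ord1.
Qed.

Lemma lprodv_iter t k (a b : A) :
  lprodv t (iter k (fun c => - del c) a) b = t ^+ k *: lprodv t a b.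
Proof.
elim: k => [|k IHk]; first by rewrite scale1r.
by rewrite iterS -scaleN1r lprodvZl lprodv_dell IHk !scalerA exprS mulN1r opprK.
Qed.

Lemma lprodv_suml t (b : A) (I : Type) (r : seq I) (F : I -> A) :
  lprodv t (\sum_(i <- r) F i) b = \sum_(i <- r) lprodv t (F i) b.
Proof.
apply: (big_morph (fun a => lprodv t a b)) => [a c|]; last exact: lprodv0l.
by have := lprodvDl t b 1 a c; rewrite !scale1r.
Qed.

(** In a left factor of degree t, -[del] acts as t, so a_(-del) v may be replaced by a_(t) v;
    associativity does the rest. *)
Lemma lprodv_mdel t (a : A) v w :
  lprodv t (mdel_prod a v) w = lprodv t a (lprodv 0 v w).
Proof.
rewrite -lprodvA addr0 [lprodv t a v]lprodvE /mdel_prod /ev !lprodv_suml.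
apply: eq_bigr => u _.
by rewrite lprodv_iter lprodvZl big_ord1.
Qed.

(** * The operator v_(0) of a 0-cocycle *)

Section Central.
Variables (v : A) (dv : forall a, mdel_prod a v = lprodv 0 v a).

Lemma central_l t (a b : A) : lprodv 0 v (lprodv t a b) = lprodv t (lprodv 0 v a) b.
Proof. by rewrite -lprodvA add0r. Qed.

(** The left side is (a_(-del) v)_(t) b, to which the cocycle condition applies. *)
Lemma central_r t (a b : A) : lprodv t a (lprodv 0 v b) = lprodv 0 v (lprodv t a b).
Proof. by rewrite -lprodv_mdel dv central_l. Qed.

Lemma central_del (a : A) : lprodv 0 v (del a) = del (lprodv 0 v a).
Proof. by rewrite lprodv_delr scale0r addr0. Qed.

Lemma sesq_central n F : sesq n F -> sesq n (fun x => lprodv 0 v (F x)).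
Proof.
move=> sF; split.
- by move=> x y e e'; rewrite (sesq_loc sF e e').
- by move=> x j t c a b le_jn; rewrite (sesq_lin sF) // linearP.
- by move=> x j lt_jn; rewrite (sesq_kill sF) // linear0.
- move=> x; rewrite (sesq_last sF) (linearD (lprodv 0 v)).
  by rewrite (linearZ_LR (lprodv 0 v)) /= central_del.
Qed.

Lemma dstream_central n (F : (nat -> point) -> A) x :
  dstream n (fun x => lprodv 0 v (F x)) x = lprodv 0 v (dstream n F x).
Proof.
rewrite /dstream !(linearD (lprodv 0 v)) (linear_sum (lprodv 0 v)).
rewrite (linearZ_LR (lprodv 0 v)); congr (_ + _ + _ *: _).
- exact: central_r.
- by apply: eq_bigr => k _; rewrite (linearZ_LR (lprodv 0 v)).
- exact/esym/central_l.
Qed.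

Lemma eval_cup0S n (g : cochain A n.+1) x :
  eval_cochain (cup0S v g) x = lprodv 0 v (eval_cochain g x).
Proof.
have e a : cup0S v g a = map_vpoly (lprodv 0 v) (g a).
  by apply: eq_bigr => u _; rewrite zero_prodE.
rewrite /eval_cochain e; exact: (ev_map_vpoly _ (lprodv 0 v)).
Qed.

Lemma cupS0E n (g : cochain A n.+1) a : cupS0 g v a = cup0S v g a.
Proof. by apply: eq_bigr => u _; rewrite dv zero_prodE. Qed.

Lemma cocycle_cup0S n (g : cochain A n.+1) : cocycle g -> cocycle (cup0S v g).
Proof.
move=> /cocycle_eval[sg dg]; apply: (eval_cocycle charC).
  by apply: eq_sesq (sesq_central sg) => x; rewrite eval_cup0S.
by move=> x; rewrite (eq_dstream _ _ (eval_cup0S g)) dstream_central dg linear0.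
Qed.

End Central.

Lemma lmul0r (a : A) : lmul a 0 = 0.
Proof.
apply: (ev_inj charC) => l.
rewrite (eq_ev (l' := fun=> l ord0)) => [|i]; last by rewrite ord1.
by rewrite -lprodvE linear0 ev0.
Qed.

(** The difference is the coboundary of zero. Degree 1 is separate, since there zero is an element
    of A and [diff0] is not a stream differential. *)
Lemma coboundary_refl n (f g : cochain A n.+1) :
  (forall a, f a = g a) -> coboundary f g.
Proof.
case: n f g => [|n] f g e.
  exists 0 => // a; rewrite e subrr /= /diff0 zero_prodE lprodv0l subr0.
  by rewrite /mdel_prod lmul0r msupp0 big_seq_fset0 malgC0E.
have E0 : eval_cochain ((fun=> 0) : cochain A n.+1) =1 (fun=> 0) by move=> x; exact: ev0.
have s0 : sesq n (eval_cochain ((fun=> 0) : cochain A n.+1)).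
  by apply: eq_sesq (sesq0 A n) => x; rewrite E0.
apply: (coboundary_eval charC (erefl n.+1) s0) => x.
rewrite (eq_dstream _ _ E0).
(* The empty sum shows that the differential of 0 is 0. *)
have := dstream_sum n.+1 0 (fun=> 0) (fun _ _ => 0) x.
rewrite [in RHS]big_geq // => d0.
rewrite -(@eq_dstream _ _ _ (fun=> \sum_(0 <= i < 0) 0 *: 0)) => [|y]; last by rewrite big_geq.
rewrite d0 (_ : eval_cochain f x = eval_cochain g x) ?subrr //.
by rewrite /eval_cochain e.
Qed.

Lemma HH_eq_refl n (f g : cochain A n.+1) :
  cocycle f -> (forall a, g a = f a) -> HH_eq f g.
Proof.
move=> cf e; have [sf df] := cocycle_eval cf.
have E x : eval_cochain f x = eval_cochain g x by rewrite /eval_cochain e.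
split; [exact: cf | | by apply: coboundary_refl => a; rewrite e].
apply: (eval_cocycle charC); first exact: eq_sesq sf.
by move=> x; rewrite -(eq_dstream _ _ E).
Qed.

Lemma HH_eq_ccast n N (e1 e2 : n.+1 = N) c (f g : cochain A n.+1) :
  HH_eq f (cscale c g) -> HH_eq (ccast e1 f) (cscale c (ccast e2 g)).
Proof. by case: N / e1 e2 => e2; rewrite (eq_axiomK e2). Qed.

Lemma cocycle0 v : @cocycle _ A 0 v -> forall a, mdel_prod a v = lprodv 0 v a.
Proof.
move=> [_ dv] a; apply/eqP; rewrite -subr_eq0 -zero_prodE.
have := dv [ffun=> a]; rewrite /= /diff0 ffunE => /eqP.
by rewrite -malgC0E malgC_eq.
Qed.

Lemma cup_comm_0S n v (g : cochain A n.+1) c :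
  @cocycle _ A 0 v -> cocycle g -> c = 1 ->
  HH_eq (cupS0 g v) (cscale c (cup0S v g)) /\
  HH_eq (cup0S v g) (cscale c (cupS0 g v)).
Proof.
move=> /cocycle0 dv cg ->; have cvg := cocycle_cup0S dv cg.
have scale1 (f : cochain A n.+1) a : cscale 1 f a = f a.
  by rewrite /= mpolyC1E scale1r.
have [_ c' _] : HH_eq (cup0S v g) (cupS0 g v) := HH_eq_refl cvg (cupS0E dv g).
split.
  by apply: HH_eq_refl c' _ => a; rewrite scale1 cupS0E.
by apply: HH_eq_refl cvg _ => a; rewrite scale1 cupS0E.
Qed.

(** Substitution of -[del] for lambda, as an additive map on all polynomials, so that it can be
    compared with coefficientwise maps. *)
Definition mdel (P : vpoly A 1) : A :=
  \sum_(u <- msupp P) iter (u ord0) (fun a : A => - del a) P@_u.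

Let iterD k : {morph iter k (fun a : A => - del a) : a b / a + b}.
Proof. by move=> a b; elim: k => //= k ->; rewrite linearD opprD. Qed.

Lemma mdelD : {morph mdel : P Q / P + Q}.
Proof.
move=> P Q.
pose iterdel (u : 'X_{1..1}) := iter (u ord0) (fun a : A => - del a).
apply: (@malg_sumD _ A A iterdel) => u a b.
exact: iterD.
Qed.

Lemma mdelU c (u : 'X_{1..1}) : mdel << c *g u >> = iter (u ord0) (fun a : A => - del a) c.
Proof.
pose iterdel (u : 'X_{1..1}) := iter (u ord0) (fun a : A => - del a).
apply: (@malg_sumU _ A A iterdel) => w a b.
exact: iterD.
Qed.

(** v_(0) commutes with every a_(t) and with [del], hence with the substitution of -[del] for t. *)
Lemma mdel_prod_central v (a b : A) :
  (forall a, mdel_prod a v = lprodv 0 v a) ->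
  mdel_prod a (lprodv 0 v b) = lprodv 0 v (mdel_prod a b).
Proof.
move=> dv; have -> : mdel_prod a (lprodv 0 v b) = mdel (map_vpoly (lprodv 0 v) (lmul a b)).
  rewrite /mdel_prod; congr mdel; apply: (ev_inj charC) => l.
  rewrite ev_map_vpoly !(eq_ev (l := l) (l' := fun=> l ord0)); try by move=> i; rewrite ord1.
  by rewrite -!lprodvE central_r.
rewrite /map_vpoly (big_morph mdel mdelD (id1 := 0)); last first.
  by rewrite /mdel msupp0 big_seq_fset0.
rewrite /mdel_prod linear_sum; apply: eq_bigr => u _.
rewrite mdelU; elim: (u ord0) => //= k ->.
by rewrite (linearN (lprodv 0 v)) /= central_del.
Qed.

(** Substituting -[del] or 0 for lambda gives the same constant term, and every other term of the
    first lies in the image of [del]. *)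
Lemma mdel_prod_zero_prod (a b : A) : exists h, mdel_prod a b - zero_prod a b = del h.
Proof.
rewrite zero_prodE lprodvE /ev /mdel_prod -sumrB.
elim/big_ind: _ => [|a' b' [h ->] [h' ->]|u _].
- by exists 0; rewrite linear0.
- by exists (h + h'); rewrite linearD.
rewrite big_ord1; case: (u ord0) => [|k] /=.
  by exists 0; rewrite expr0 scale1r subrr linear0.
exists (- iter k (fun a : A => - del a) (lmul a b)@_u).
by rewrite exprS mul0r scale0r subr0 linearN.
Qed.

(** As w is a cocycle, w_(0) v = v_(-del) w, which is v_(0) w modulo the image of [del]. *)
Lemma cup_comm_00 v w : @cocycle _ A 0 v -> @cocycle _ A 0 w ->
  @HH_eq _ A 0 (cup00 w v) (cscale 1 (cup00 v w)).
Proof.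
move=> cv cw; have dv := cocycle0 cv; have dw := cocycle0 cw.
have C00 (a b : A) : (forall c, mdel_prod c a = lprodv 0 a c) ->
    (forall c, mdel_prod c b = lprodv 0 b c) -> @cocycle _ A 0 (cup00 a b).
  move=> da db; split=> // c; rewrite /= /diff0 /cup00 !zero_prodE.
  (* c_(-del) (a_(0) b) = a_(0) (c_(-del) b) = a_(0) (b_(0) c) = (a_(0) b)_(0) c. *)
  rewrite mdel_prod_central // db -lprodvA addr0 subrr; exact: malgC0E.
split; first exact: C00.
  by rewrite /= scale1r; apply: C00.
rewrite /= scale1r /cup00 zero_prodE -dw; exact: mdel_prod_zero_prod.
Qed.

End DegreeZero.

Theorem theorem4p2 (C : closedFieldType) (charC : [pchar C] =i pred0)
    (A : assocConfAlg C) (m n : nat) (f : cochain A m) (g : cochain A n) :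
  cocycle f -> cocycle g ->
  HH_eq (ccast (addnC n m) (cup g f)) (cscale ((-1) ^+ (m * n)) (cup f g)).
Proof.
case: m f => [|m] f; case: n g => [|n] g cf cg.
- by rewrite (eq_axiomK (addnC 0 0)); apply: cup_comm_00.
- rewrite [cup g f]/(ccast (esym (addn0 n.+1)) (cupS0 g f)).
  (* The two casts go back and forth between n + 1 and n + 1 + 0; they cancel because equality
     proofs between naturals are unique. *)
  have -> : ccast (addnC n.+1 0) (ccast (esym (addn0 n.+1)) (cupS0 g f)) = cupS0 g f.
    rewrite /ccast; move: (esym (addn0 n.+1)) (addnC n.+1 0).
    by case: (n.+1 + 0)%N / => e; rewrite (eq_axiomK e).
  have c1 : (-1) ^+ (0 * n.+1) = 1 :> C by rewrite mul0n.
  exact: (cup_comm_0S charC cf cg c1).1.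
- apply: (@HH_eq_ccast _ _ m _ (addnC 0 m.+1) (esym (addn0 m.+1))).
  have c1 : (-1) ^+ (m.+1 * 0) = 1 :> C by rewrite muln0.
  exact: (cup_comm_0S charC cg cf c1).2.
- exact: (cup_comm_pos charC).
Qed.
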